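(* Let $X$ be a well-ordered set, $>$ a monomial-center ordering on $[X^+]_\omega$ and $D=Disgp\langle X\mid S\rangle$, where $S=\{([u_i]_{m_i},[v_i]_{n_i})\mid [u_i]_{m_i}>[v_i]_{n_i},\ i\in I\}$ is a subset of $[X^+]_\omega\times[X^+]_\omega$. Let $S^{comp}$ be the Gröbner-Shirshov basis in $Di\langle X\rangle$ obtained by the Shirshov algorithm from the set of polynomials $\{[u_i]_{m_i}-[v_i]_{n_i}\mid i\in I\}$. Then $Irr(S^{comp})$ is a set of normal forms of elements of the disemigroup $Disgp\langle X\mid S\rangle$, i.e. every element (congruence class) of $Disgp\langle X\mid S\rangle$ contains exactly one element of $Irr(S^{comp})$.
   Context: Disemigroups. A disemigroup is a set with two associative binary operations $\vdash,\dashv$ satisfying $a\dashv(b\vdash c)=a\dashv(b\dashv c)$, $(a\dashv b)\vdash c=(a\vdash b)\vdash c$, $a\vdash(b\dashv c)=(a\vdash b)\dashv c$. $X^+$ is the set of nonempty words on $X$, $X^*$ the set of all words including the empty one, $|u|$ the length of $u$. $[X^+]_\omega=\{[u]_m\mid u\in X^+,\ 1\le m\le |u|\}$ is the set of normal diwords (formal pairs $(u,m)$); $u$ is the associative word and $p([u]_m)=m$ the position of center. With $[u]_m\vdash[v]_n=[uv]_{|u|+n}$, $[u]_m\dashv[v]_n=[uv]_m$, it is the free disemigroup on $X$. $Disgp\langle X\mid S\rangle:=[X^+]_\omega/\rho(S)$, where $\rho(S)$ is the congruence on $([X^+]_\omega,\vdash,\dashv)$ generated by $S$. $\mathbf{k}$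 is a fixed field; $Di\langle X\rangle$ (the free dialgebra) is the $\mathbf{k}$-space with basis $[X^+]_\omega$ and the products $\vdash,\dashv$ given on basis elements by $[u]_m\vdash[v]_n=[uv]_{|u|+n}$, $[u]_m\dashv[v]_n=[uv]_m$ and extended bilinearly ($x\in X$ is identified with $[x]_1$). An ideal is a subspace closed under both products, on both sides, with arbitrary elements; $Id(S)$ is the ideal generated by $S$. Orderings. A monomial ordering on $X^+$ is a well (total) ordering with $u>v\Rightarrow uw>vw,\ wu>wv$. The associated monomial-center ordering on $[X^+]_\omega$ is: $[u]_m>[v]_n$ iff $(u,m)>(v,n)$ lexicographically. For $0\ne f\in Di\langle X\rangle$: $\overline f$ is the leading (largest) normal diword of $f$, $lc(f)$ its coefficient, $lt(f)=lc(f)\overline f$, $\widetilde f$ the associative word of $\overline f$, $r_f=f-lt(f)$. By convention $0$ is smaller than every diword and every word, and $\overline 0=\widetilde 0=0$. $f\neq0$ is monic if $lc(f)=1$; a set is monic if all its elements are. $f\ne0$ is strong if $\widetilde f>\widetilde{r_f}$ (in particular if $r_f=0$). Normal $S$-diwords (for a monic $S\subset Di\langle X\rangle$). For $s\in S$, $a,b\in X^*$ put $P([asb])=\{n: 1\le n\le|a|\}\cup\{|a|+p(\overline s)\}\cup\{n:|a\widetilde s|<n\le|a\widetilde sb|\}$ if $s$ is strong, and $P([asb])=\{|a|+p(\overline s)\}$ if $s$ is not strong. For $l\in P([asb])$ the normal $S$-diword $[asb]_l$ is the element: $[a]_l\dashv s\dashv[b]_1$ if $l\le|a|$; $[a]_{|a|}\vdash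 s\dashv[b]_1$ if $l=|a|+p(\overline s)$; $[a]_{|a|}\vdash s\vdash[b]_{l-|a\widetilde s|}$ if $l>|a\widetilde s|$ (factors with empty word omitted). One has $\overline{[asb]_l}=[a\widetilde sb]_l$. $Irr(S)$ is the set of $[u]_n\in[X^+]_\omega$ not equal to $\overline{[asb]_m}$ for any normal $S$-diword $[asb]_m$. Compositions of monic $f,g\in Di\langle X\rangle$ (same notation $[afb]_l$, $P$ used for single polynomials): 1) If $f$ is not strong: $x\dashv f$ for all $x\in X$ and $f\vdash[u]_{|u|}$ for all $u\in X^+$. 2) If $w=\widetilde f=a\widetilde gb$, $a,b\in X^*$: if $p(\overline f)\in P([agb])$, $f-[agb]_{p(\overline f)}$; if $p(\overline f)\notin P([agb])$ and both $f,g$ are strong, for every $x\in X$, $[xf]_1-[xagb]_1$ and $[fx]_{|wx|}-[agbx]_{|wx|}$. 3) If $w=\widetilde fb=a\widetilde g$, $a,b\in X^*$, $|\widetilde f|+|\widetilde g|>|w|$: if $P([fb])\cap P([ag])\ne\varnothing$, for every $m$ in it $[fb]_m-[ag]_m$; if $P([fb])\cap P([ag])=\varnothing$ and both $f,g$ are strong, for every $x\in X$, $[xfb]_1-[xag]_1$ and $[fbx]_{|wx|}-[agx]_{|wx|}$. $h$ is trivial modulo $S$ if $h=\sum\alpha_i[a_is_ib_i]_{m_i}$ is a finite sum with $\alpha_i\in\mathbf{k}$, $[a_is_ib_i]_{m_i}$ normal $S$-diwords and $\overline{[a_is_ib_i]_{m_i}}\le\overline h$. A monic set $S$ is a Gröbner-Shirshov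 basis in $Di\langle X\rangle$ if every composition of elements of $S$ is trivial modulo $S$. Shirshov algorithm: starting from a monic set $S$, repeatedly add all nontrivial compositions (made monic); the result is a Gröbner-Shirshov basis $S^{comp}\supseteq S$ with $Id(S^{comp})=Id(S)$. *)

(* Defs.v *)
From HB Require Import structures.
From mathcomp Require Import all_boot all_algebra.
From mathcomp Require Import finmap monalg.
From Stdlib Require Import FunctionalExtensionality PropExtensionality.
From Stdlib Require Import ProofIrrelevance Classical.

Set Implicit Arguments.
Unset Strict Implicit.
Unset Printing Implicit Defensive.

Import GRing.Theory.
Local Open Scope ring_scope.

Reserved Notation "x ⊢ y" (at level 40, left associativity).
Reserved Notation "x ⊣ y" (at level 40, left associativity).

(** * Disemigroups, congruences, quotients *)

Record disemigroup := Disemigroup {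
  dis_sort :> Type;
  dis_vdash : dis_sort -> dis_sort -> dis_sort;
  dis_dashv : dis_sort -> dis_sort -> dis_sort;
  dis_vdashA : associative dis_vdash;
  dis_dashvA : associative dis_dashv;
  dis_dashv_vdash : forall a b c,
    dis_dashv a (dis_vdash b c) = dis_dashv a (dis_dashv b c);
  dis_vdash_dashv : forall a b c,
    dis_vdash (dis_dashv a b) c = dis_vdash (dis_vdash a b) c;
  dis_vdash_dashvA : forall a b c,
    dis_vdash a (dis_dashv b c) = dis_dashv (dis_vdash a b) c
}.

Record is_congruence (D : disemigroup) (R : D -> D -> Prop) : Prop :=
  IsCongruence {
    cong_refl : forall x, R x x;
    cong_sym : forall x y, R x y -> R y x;
    cong_trans : forall x y z, R x y -> R y z -> R x z;
    cong_vdash : forall x x' y y', R x x' -> R y y' ->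
      R (dis_vdash x y) (dis_vdash x' y');
    cong_dashv : forall x x' y y', R x x' -> R y y' ->
      R (dis_dashv x y) (dis_dashv x' y')
  }.

Definition congruence_gen (D : disemigroup) (S : D -> D -> Prop) (x y : D) :=
  forall R : D -> D -> Prop, is_congruence R ->
    (forall p q, S p q -> R p q) -> R x y.

Lemma congruence_genP (D : disemigroup) (S : D -> D -> Prop) :
  is_congruence (congruence_gen S).
Proof.
split.
- by move=> x R cR _; apply: (cong_refl cR).
- by move=> x y xy R cR SR; apply: (cong_sym cR); apply: xy.
- by move=> x y z xy yz R cR SR; apply: (cong_trans cR (xy R cR SR)); apply: yz.
- by move=> x x' y y' xx yy R cR SR; apply: (cong_vdash cR); [apply: xx|apply: yy].
- by move=> x x' y y' xx yy R cR SR; apply: (cong_dashv cR); [apply: xx|apply: yy].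
Qed.

Record cong_class (D : disemigroup) (R : D -> D -> Prop) := CongClass {
  in_class : D -> Prop;
  in_classP : exists x, forall y, in_class y <-> R x y
}.

Section Quotient.
Variables (D : disemigroup) (R : D -> D -> Prop) (cR : is_congruence R).

Lemma cong_class_eq (A B : cong_class R) x :
  in_class A x -> in_class B x -> A = B.
Proof.
case: A B => [A [a Aa]] [B [b Bb]] /= /Aa ax /Bb bx.
have AB : A = B.
  apply: functional_extensionality => y; apply: propositional_extensionality.
  have ab := cong_trans cR ax (cong_sym cR bx).
  split=> [/Aa ay|/Bb byy]; first apply/Bb.
    exact: (cong_trans cR (cong_sym cR ab) ay).
  by apply/Aa; apply: (cong_trans cR ab byy).
by case: _ / AB Bb => Bb; congr CongClass; apply: proof_irrelevance.
Qed.

Section Op.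
Variables (op : D -> D -> D).
Hypothesis opR : forall x x' y y', R x x' -> R y y' -> R (op x y) (op x' y').

Definition class_op_set (A B : cong_class R) (z : D) :=
  exists x y, [/\ in_class A x, in_class B y & R (op x y) z].

Lemma class_op_subproof A B :
  exists x, forall y, class_op_set A B y <-> R x y.
Proof.
case: A B => [A [a Aa]] [B [b Bb]]; exists (op a b) => z; split.
  case=> x [y] /= [/Aa ax /Bb byy xyz].
  exact: (cong_trans cR (opR ax byy) xyz).
by move=> abz; exists a, b; split=> //=;
  [apply/Aa; apply: (cong_refl cR)|apply/Bb; apply: (cong_refl cR)].
Qed.

Definition class_op (A B : cong_class R) : cong_class R :=
  CongClass (class_op_subproof A B).

Lemma in_class_op A B x y :
  in_class A x -> in_class B y -> in_class (class_op A B) (op x y).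
Proof. by move=> Ax By; exists x, y; split=> //; apply: (cong_refl cR). Qed.

End Op.

Lemma in_class_ex (A : cong_class R) : exists x, in_class A x.
Proof. by case: A => A [a Aa]; exists a; apply/Aa; apply: (cong_refl cR). Qed.

Definition class_vdash := class_op (cong_vdash cR).
Definition class_dashv := class_op (cong_dashv cR).

Definition quotient_disemigroup : disemigroup.
Proof.
refine (@Disemigroup (cong_class R) class_vdash class_dashv _ _ _ _ _);
  move=> A B C; case: (in_class_ex A) (in_class_ex B) (in_class_ex C)
    => [a Aa] [b Bb] [c Cc].
- apply: (@cong_class_eq _ _ (dis_vdash a (dis_vdash b c))).
    by do !apply: (in_class_op (cong_vdash cR)).
  by rewrite dis_vdashA; do !apply: (in_class_op (cong_vdash cR)).
- apply: (@cong_class_eq _ _ (dis_dashv a (dis_dashv b c))).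
    by do !apply: (in_class_op (cong_dashv cR)).
  by rewrite dis_dashvA; do !apply: (in_class_op (cong_dashv cR)).
- apply: (@cong_class_eq _ _ (dis_dashv a (dis_vdash b c))).
    by apply: (in_class_op (cong_dashv cR)) => //;
       apply: (in_class_op (cong_vdash cR)).
  by rewrite dis_dashv_vdash; do !apply: (in_class_op (cong_dashv cR)).
- apply: (@cong_class_eq _ _ (dis_vdash (dis_dashv a b) c)).
    by apply: (in_class_op (cong_vdash cR)) => //;
       apply: (in_class_op (cong_dashv cR)).
  by rewrite dis_vdash_dashv; do !apply: (in_class_op (cong_vdash cR)).
- apply: (@cong_class_eq _ _ (dis_vdash a (dis_dashv b c))).
    by apply: (in_class_op (cong_vdash cR)) => //;
       apply: (in_class_op (cong_dashv cR)).
  rewrite dis_vdash_dashvA; apply: (in_class_op (cong_dashv cR)) => //.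
  exact: (in_class_op (cong_vdash cR)).
Defined.

End Quotient.

(** * Normal diwords and the free disemigroup *)

(* [u]_m is the pair (u, m); positions are 1-based, so the bounds on m also
   force u to be nonempty. *)
Record diword (X : choiceType) := Diword {
  diword_val : seq X * nat;
  _ : (0 < diword_val.2 <= size diword_val.1)%N
}.

HB.instance Definition _ (X : choiceType) := [isSub for @diword_val X].
HB.instance Definition _ (X : choiceType) := [Choice of diword X by <:].

Section Diword.
Variable X : choiceType.
Implicit Types d e : diword X.

Definition aword d : seq X := (val d).1.
Definition center d : nat := (val d).2.

Lemma diword_vdash_subproof d e :
  (0 < size (aword d) + center e <= size (aword d ++ aword e))%N.
Proof.
rewrite size_cat leq_add2l /center /aword.
by case: e => /= -[v n] /andP[/= n0 ->]; rewrite addn_gt0 n0 orbT.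
Qed.

Definition diword_vdash d e : diword X :=
  @Diword X (aword d ++ aword e, size (aword d) + center e)%N
    (diword_vdash_subproof d e).

Lemma diword_dashv_subproof d e :
  (0 < center d <= size (aword d ++ aword e))%N.
Proof.
rewrite size_cat /center /aword.
by case: d => /= -[u m] /andP[/= -> mu]; apply: leq_trans mu (leq_addr _ _).
Qed.

Definition diword_dashv d e : diword X :=
  @Diword X (aword d ++ aword e, center d) (diword_dashv_subproof d e).

Definition free_disemigroup : disemigroup.
Proof.
refine (@Disemigroup (diword X) diword_vdash diword_dashv _ _ _ _ _);
  move=> a b c; apply: val_inj;
  by rewrite /diword_vdash /diword_dashv /aword /center /=
             ?size_cat ?catA ?addnA.
Defined.

Definition Disgp (S : diword X -> diword X -> Prop) : disemigroup :=
  quotient_disemigroup (@congruence_genP free_disemigroup S).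

End Diword.

(** * Orderings *)

Definition strict_well_order (T : eqType) (lt : rel T) : Prop :=
  [/\ irreflexive lt, transitive lt,
      forall x y, x != y -> lt x y || lt y x
    & well_founded (fun x y => lt x y)].

(* A monomial ordering lives on the nonempty words; the values of [ltw] on the
   empty word are irrelevant. *)
Definition monomial_ordering (X : choiceType) (ltw : rel (seq X)) : Prop :=
  strict_well_order (fun u v : {u : seq X | u != [::]} => ltw (val u) (val v))
  /\ forall u v w : seq X, u != [::] -> v != [::] -> w != [::] ->
       ltw v u -> ltw (v ++ w) (u ++ w) /\ ltw (w ++ v) (w ++ u).

Definition diword_lt (X : choiceType) (ltw : rel (seq X)) : rel (diword X) :=
  fun d e => ltw (aword d) (aword e)
             || (aword d == aword e) && (center d < center e)%N.

(** * The free dialgebra *)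

Notation Di k X := {malg k[diword X]}.

Section Dialgebra.
Variables (k : fieldType) (X : choiceType).
Implicit Types f g h : Di k X.

Definition bilinear_ext (op : diword X -> diword X -> diword X) f g : Di k X :=
  \sum_(d <- msupp f) \sum_(e <- msupp g) << f@_d * g@_e *g op d e >>.

Definition di_vdash f g := bilinear_ext (@diword_vdash X) f g.
Definition di_dashv f g := bilinear_ext (@diword_dashv X) f g.

(* [u]_m as an element of Di<X>; 0 unless 1 <= m <= |u|. *)
Definition diw (u : seq X) (m : nat) : Di k X :=
  if insub (u, m) is Some d then << d >> else 0.

End Dialgebra.

Notation "f ⊢ g" := (di_vdash f g) : ring_scope.
Notation "f ⊣ g" := (di_dashv f g) : ring_scope.

Section GroebnerShirshov.
Variables (k : fieldType) (X : choiceType) (ltw : rel (seq X)).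
Implicit Types (f g h s : Di k X) (S : Di k X -> Prop).

(* None stands for the leading diword of 0, and lies below all diwords. *)
Definition lead f : option (diword X) :=
  ohead [seq d <- msupp f
        | all (fun e => (e == d) || diword_lt ltw e d) (msupp f)].

Definition lead_le (o o' : option (diword X)) : bool :=
  match o, o' with
  | None, _ => true
  | Some _, None => false
  | Some d, Some e => (d == e) || diword_lt ltw d e
  end.

Definition lc f : k := if lead f is Some d then f@_d else 0.
Definition lead_word f : seq X := if lead f is Some d then aword d else [::].
Definition lead_center f : nat := if lead f is Some d then center d else 0%N.
Definition lead_term f : Di k X :=
  if lead f is Some d then << lc f *g d >> else 0.
Definition rest f : Di k X := f - lead_term f.

Definition strong f : bool :=
  (f != 0) && ((rest f == 0) || ltw (lead_word (rest f)) (lead_word f)).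

(** ** Normal S-diwords *)

Definition centers (a : seq X) s (b : seq X) : pred nat := fun n =>
  (n == size a + lead_center s)%N
  || strong s && ((1 <= n <= size a)
                  || (size (a ++ lead_word s) < n
                      <= size (a ++ lead_word s ++ b)))%N.

(* [a]_{|a|} ⊢ f and f ⊣ [b]_1, the factor being omitted for an empty word. *)
Definition vdash_word (a : seq X) f : Di k X :=
  if a is [::] then f else diw k a (size a) ⊢ f.
Definition dashv_word f (b : seq X) : Di k X :=
  if b is [::] then f else f ⊣ diw k b 1.

(* [asb]_l, meaningful only for l \in centers a s b. *)
Definition sdiword (a : seq X) s (b : seq X) (l : nat) : Di k X :=
  if (l <= size a)%N then dashv_word (diw k a l ⊣ s) b
  else if l == (size a + lead_center s)%N then dashv_word (vdash_word a s) b
  else vdash_word a s ⊢ diw k b (l - size (a ++ lead_word s)).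

Definition Irr S (d : diword X) : Prop :=
  forall a s b m, S s -> m \in centers a s b -> lead (sdiword a s b m) <> Some d.

(** ** Compositions *)

Inductive composition S : Di k X -> Prop :=
| comp_left f x : S f -> ~~ strong f ->
    composition S (diw k [:: x] 1 ⊣ f)
| comp_right f u : S f -> ~~ strong f -> u != [::] ->
    composition S (f ⊢ diw k u (size u))
| comp_incl f g a b : S f -> S g ->
    lead_word f = a ++ lead_word g ++ b ->
    lead_center f \in centers a g b ->
    composition S (f - sdiword a g b (lead_center f))
| comp_incl_left f g a b x : S f -> S g ->
    lead_word f = a ++ lead_word g ++ b ->
    lead_center f \notin centers a g b -> strong f -> strong g ->
    composition S (sdiword [:: x] f [::] 1 - sdiword (x :: a) g b 1)
| comp_incl_right f g a b x : S f -> S g ->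
    lead_word f = a ++ lead_word g ++ b ->
    lead_center f \notin centers a g b -> strong f -> strong g ->
    composition S (sdiword [::] f [:: x] (size (lead_word f)).+1
                   - sdiword a g (rcons b x) (size (lead_word f)).+1)
| comp_inter f g a b m : S f -> S g ->
    lead_word f ++ b = a ++ lead_word g ->
    (size (lead_word f ++ b) < size (lead_word f) + size (lead_word g))%N ->
    m \in centers [::] f b -> m \in centers a g [::] ->
    composition S (sdiword [::] f b m - sdiword a g [::] m)
| comp_inter_left f g a b x : S f -> S g ->
    lead_word f ++ b = a ++ lead_word g ->
    (size (lead_word f ++ b) < size (lead_word f) + size (lead_word g))%N ->
    (forall m, ~~ ((m \in centers [::] f b) && (m \in centers a g [::]))) ->
    strong f -> strong g ->
    composition S (sdiword [:: x] f b 1 - sdiword (x :: a) g [::] 1)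
| comp_inter_right f g a b x : S f -> S g ->
    lead_word f ++ b = a ++ lead_word g ->
    (size (lead_word f ++ b) < size (lead_word f) + size (lead_word g))%N ->
    (forall m, ~~ ((m \in centers [::] f b) && (m \in centers a g [::]))) ->
    strong f -> strong g ->
    composition S (sdiword [::] f (rcons b x) (size (lead_word f ++ b)).+1
                   - sdiword a g [:: x] (size (lead_word f ++ b)).+1).

Definition trivial_mod S h : Prop :=
  exists (n : nat) (alpha : 'I_n -> k) (a b : 'I_n -> seq X)
         (s : 'I_n -> Di k X) (m : 'I_n -> nat),
    (forall i, [/\ S (s i), m i \in centers (a i) (s i) (b i)
                 & lead_le (lead (sdiword (a i) (s i) (b i) (m i))) (lead h)])
    /\ h = \sum_i alpha i *: sdiword (a i) (s i) (b i) (m i).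

Definition GS_basis S : Prop :=
  (forall s, S s -> lc s = 1) /\ forall h, composition S h -> trivial_mod S h.

(** ** The Shirshov algorithm *)

Definition shirshov_step S : Di k X -> Prop := fun f =>
  S f \/ exists h, [/\ composition S h, ~ trivial_mod S h & f = (lc h)^-1 *: h].

(* Each step adds, at once, all the nontrivial compositions of the current set,
   made monic; the completion is the union of all the stages. *)
Definition shirshov S : Di k X -> Prop := fun f =>
  exists n, iter n shirshov_step S f.

End GroebnerShirshov.

Definition binomials (k : fieldType) (X : choiceType)
    (S : diword X -> diword X -> Prop) : Di k X -> Prop :=
  fun f => exists p q, S p q /\ f = << p >> - << q >>.

Arguments binomials k {X} S.

(** The Shirshov completion of a monic set is a Groebner-Shirshov basis. *)

Section ShirshovGS.
Variables (k : fieldType) (X : choiceType) (ltw : rel (seq X)).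
Hypothesis mon : monomial_ordering ltw.
Implicit Types (f g h s : Di k X) (S : Di k X -> Prop) (d e : diword X).

Lemma aword_neq0 d : aword d != [::].
Proof. by rewrite /aword; case: d => [[u m]] /=; case: u => //=; case: m. Qed.
Lemma center_gt0 d : (0 < center d)%N.
Proof. by rewrite /center; case: d => [[u m]] /= /andP[]. Qed.

Let nword d : {u : seq X | u != [::]} := exist _ (aword d) (aword_neq0 d).

Lemma diword_lt_irr d : diword_lt ltw d d = false.
Proof.
case: mon => -[irr _ _ _] _; rewrite /diword_lt ltnn andbF orbF.
exact: (irr (nword d)).
Qed.

Lemma diword_lt_trans : transitive (diword_lt ltw).
Proof.
case: mon => -[_ tr _ _] _ e d f; rewrite /diword_lt.
case/orP=> [de|/andP[/eqP de de']] /orP[ef|/andP[/eqP ef ef']].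
- by rewrite (tr (nword e) (nword d) (nword f)).
- by rewrite -ef de.
- by rewrite de ef.
- by rewrite de ef eqxx (ltn_trans de' ef') orbT.
Qed.

Lemma diword_lt_total d e : d != e -> diword_lt ltw d e || diword_lt ltw e d.
Proof.
case: mon => -[_ _ tot _] _ de; rewrite /diword_lt.
have [wde|wde] := eqVneq (aword d) (aword e); last first.
  have /orP[] : ltw (aword d) (aword e) || ltw (aword e) (aword d).
    by apply: (tot (nword d) (nword e)).
  - by move=> ->.
  - by move=> ->; rewrite orbT.
rewrite ?wde ?eqxx /=; have [||cde] := ltngtP (center d) (center e).
- by rewrite orbT.
- by rewrite !orbT.
case/eqP: de; apply: val_inj; move: wde cde; rewrite /aword /center.
by case: (val d) (val e) => [? ?] [? ?] /= -> ->.
Qed.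

Lemma lead_max f d : d \in msupp f ->
  (forall e, e \in msupp f -> e != d -> diword_lt ltw e d) -> lead ltw f = Some d.
Proof.
move=> df dmax; rewrite /lead.
set r := [seq _ <- _ | _].
have dr : d \in r.
  rewrite mem_filter; apply/andP; split=> //; apply/allP=> e ef.
  by case: eqVneq => //= ne; apply: dmax.
case r_e : r dr => [//|e r'] _ /=; congr Some.
have : e \in r by rewrite r_e mem_head.
rewrite mem_filter => /andP[/allP/(_ d df)] /orP[/eqP//|de] ef.
apply/eqP/negPn/negP => /(dmax _ ef) ed.
by have := diword_lt_trans de ed; rewrite diword_lt_irr.
Qed.

Lemma max_ex (r : seq (diword X)) : r != [::] ->
  exists2 d, d \in r & forall e, e \in r -> e != d -> diword_lt ltw e d.
Proof.
elim: r => // a [|b r] IH _.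
  by exists a; rewrite ?mem_head // => e; rewrite inE => ->.
have [d dr dmax] := IH isT.
have [ad|ad] := eqVneq a d.
  exists d; first by rewrite inE dr orbT.
  by move=> e; rewrite inE => /orP[/eqP->|]; [rewrite ad eqxx|apply: dmax].
case/orP: (diword_lt_total ad) => h.
  exists d; first by rewrite inE dr orbT.
  by move=> e; rewrite inE => /orP[/eqP-> //|]; apply: dmax.
exists a; first by rewrite mem_head.
move=> e; rewrite inE => /orP[/eqP->|]; first by rewrite eqxx.
move=> er _; have [->//|ne] := eqVneq e d.
exact: diword_lt_trans (dmax _ er ne) h.
Qed.

Lemma lead_some f : f != 0 -> exists2 d, lead ltw f = Some d & d \in msupp f.
Proof.
move=> f0; have [|d df dm] := @max_ex (msupp f).
  move/eqP: f0 => f0; apply/eqP => e; apply: f0; apply/malgP => x.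
  rewrite mcoeff0; apply/eqP; rewrite mcoeff_eq0.
  by change (x \notin (msupp f : seq _)); rewrite e.
by exists d => //; apply: lead_max.
Qed.

Lemma lc_neq0 f : f != 0 -> lc ltw f != 0.
Proof. by move=> /lead_some[d fd df]; rewrite /lc fd mcoeff_neq0. Qed.

Lemma leadZ c f : c != 0 -> lead ltw (c *: f) = lead ltw f.
Proof. by move=> c0; rewrite /lead msuppZ (negbTE c0). Qed.

Lemma binomials_monic (S : diword X -> diword X -> Prop) f :
  (forall p q, S p q -> diword_lt ltw q p) -> binomials k S f -> lc ltw f = 1.
Proof.
move=> Sgt [p [q [/Sgt qp ->]]].
have npq : p != q.
  by apply/eqP => e; move: qp; rewrite e diword_lt_irr.
have c1 : (<< p >> - << q >> : Di k X)@_p = 1.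
  by rewrite mcoeffB !mcoeffU eqxx eq_sym (negbTE npq) mulr0n subr0.
rewrite /lc (@lead_max _ p) //.
  by rewrite -mcoeff_neq0 c1 oner_eq0.
move=> e; rewrite -mcoeff_neq0 mcoeffB !mcoeffU => h nep.
move: h; rewrite [p == e]eq_sym (negbTE nep) mulr0n sub0r oppr_eq0.
by have [<-//|_] := eqVneq q e; rewrite ?mulr0n ?eqxx.
Qed.

Lemma trivial_sub S S' h : (forall f, S f -> S' f) ->
  trivial_mod ltw S h -> trivial_mod ltw S' h.
Proof.
move=> SS [n [al [a [b [s [m [H e]]]]]]].
by exists n, al, a, b, s, m; split=> // i; have [? ? ?] := H i; split; auto.
Qed.

Lemma stage_mono S i j f : (i <= j)%N ->
  iter i (shirshov_step ltw) S f -> iter j (shirshov_step ltw) S f.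
Proof.
move=> /subnK <-; elim: (j - i)%N => // n IH H.
by rewrite addSn iterS; left; apply: IH.
Qed.

Lemma comp_stage S h : composition ltw (shirshov ltw S) h ->
  exists n, composition ltw (iter n (shirshov_step ltw) S) h.
Proof.
case=> [f x [n Sf] ?|f u [n Sf] ? ?|f g a b [i Si] [j Sj] *|f g a b x [i Si] [j Sj] *|f g a b x [i Si] [j Sj] *|f g a b m [i Si] [j Sj] *|f g a b x [i Si] [j Sj] *|f g a b x [i Si] [j Sj] *].
1,2: by exists n; constructor.
all: exists (maxn i j).
all: move: (stage_mono (leq_maxl i j) Si) (stage_mono (leq_maxr i j) Sj) => ? ?.
- by apply: comp_incl.
- by apply: comp_incl_left.
- by apply: comp_incl_right.
- by apply: comp_inter.
- by apply: comp_inter_left.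
- by apply: comp_inter_right.
Qed.

Lemma trivial0 S : trivial_mod ltw S 0.
Proof.
exists 0%N, (fun=> 0), (fun=> [::]), (fun=> [::]), (fun=> 0), (fun=> 0%N).
by split=> [[]//|]; rewrite big_ord0.
Qed.

Lemma nontrivial_neq0 S h : ~ trivial_mod ltw S h -> h != 0.
Proof. by move=> nt; apply/eqP => e; apply: nt; rewrite e; apply: trivial0. Qed.

Lemma sdiword0 s : s != 0 -> sdiword ltw [::] s [::] (lead_center ltw s) = s.
Proof.
move=> /lead_some[d e _]; rewrite /sdiword /lead_center e /=.
by rewrite leqn0 eqn0Ngt center_gt0 /= add0n eqxx.
Qed.

Lemma shirshov_GS_basis S :
  (forall s, S s -> lc ltw s = 1) -> GS_basis ltw (shirshov ltw S).
Proof.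
move=> mS; split.
  move=> s [n]; elim: n s => [|n IH] s /=; first exact: mS.
  case=> [/IH//|[h [_ /nontrivial_neq0 h0 ->]]].
  have c0 := lc_neq0 h0.
  rewrite {1}/lc leadZ ?invr_eq0 //; move: c0; rewrite /lc.
  by case: lead => [d|]; rewrite ?eqxx // mcoeffZ => /mulVf.
move=> h /comp_stage[n ch].
have [tr|nt] := classic (trivial_mod ltw (iter n (shirshov_step ltw) S) h).
  by apply: trivial_sub tr => f; exists n.
have h0 := nontrivial_neq0 nt; have c0 := lc_neq0 h0.
pose f := (lc ltw h)^-1 *: h.
have f0 : f != 0 by rewrite scaler_eq0 invr_eq0 negb_or c0.
have lf : lead ltw f = lead ltw h by rewrite leadZ ?invr_eq0.
have Sf : shirshov ltw S f by exists n.+1; right; exists h.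
exists 1%N, (fun=> lc ltw h), (fun=> [::]), (fun=> [::]), (fun=> f),
  (fun=> lead_center ltw f); split=> [i|].
  split=> //; first by rewrite unfold_in /centers eqxx.
  by rewrite sdiword0 // lf; case: lead => //= d; rewrite eqxx.
by rewrite big_ord1 sdiword0 // scalerA mulfV // scale1r.
Qed.
End ShirshovGS.

(* Main.v *)
(** Every polynomial of [shirshov ltw (binomials k S)] is again a binomial
    [p - q] with [q < p] and [p], [q] congruent, so a normal diword of the basis
    is a rewriting step [P -> Q] between congruent diwords, and the diwords of
    [Irr] are those that no step changes. Existence follows since the ordering
    is well founded. Uniqueness is confluence: triviality of a composition
    [u - v] means, applying to it the linear form that is the indicator of a
    connected component, that [u] and [v] are joined by steps which never
    exceed [max u v]. Every critical pair is a composition placed in a context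
    or two commuting disjoint steps, so by well-founded induction normal forms
    are unique, and having the same normal form is then a congruence. *)

Require Import Defs.
From mathcomp Require Import all_boot all_algebra.
From mathcomp Require Import finmap monalg zify.
From Stdlib Require Import Classical ClassicalEpsilon.
From Stdlib Require Import Relations.

Set Implicit Arguments.
Unset Strict Implicit.
Unset Printing Implicit Defensive.

Import GRing.Theory.
Local Open Scope ring_scope.

(** * Products and leading terms of binomials *)

Section Products.
Variables (k : fieldType) (X : choiceType).
Implicit Types (p q d e : diword X) (f g : Di k X) (u : seq X).

(** Linear extension of [phi]. Either product with a fixed basis diword has this form, which is why
    binomials are sent to binomials. *)
Definition push (phi : diword X -> diword X) g : Di k X :=
  \sum_(e <- msupp g) << g@_e *g phi e >>.

Lemma pushEw phi g (B : {fset diword X}) : (msupp g `<=` B)%fset ->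
  push phi g = \sum_(e <- B) << g@_e *g phi e >>.
Proof.
move=> gB; rewrite /push (big_fset_incl _ gB) // => e _ /mcoeff_outdom ->.
exact: monalgU0.
Qed.

Lemma pushB phi f g : push phi (f - g) = push phi f - push phi g.
Proof.
pose B := (msupp f `|` msupp g)%fset.
rewrite (pushEw phi (msuppB_le f g : (_ `<=` B)%fset)).
rewrite (@pushEw phi f B) ?fsubsetUl // (@pushEw phi g B) ?fsubsetUr //.
by rewrite -sumrB; apply: eq_bigr => e _; rewrite mcoeffB monalgUB.
Qed.

Lemma pushU phi d : push phi << d >> = << phi d >>.
Proof. by rewrite /push msuppU oner_eq0 big_seq_fset1 mcoeffUU. Qed.

Lemma bilinear_extUl op d g : bilinear_ext op << d >> g = push (op d) g.
Proof.
rewrite /bilinear_ext msuppU oner_eq0 big_seq_fset1 mcoeffUU.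
by apply: eq_bigr => e _; rewrite mul1r.
Qed.

Lemma bilinear_extUr op e f : bilinear_ext op f << e >> = push (op ^~ e) f.
Proof.
rewrite /bilinear_ext; apply: eq_bigr => d _.
by rewrite msuppU oner_eq0 big_seq_fset1 mcoeffUU mulr1.
Qed.

Lemma pushUB phi p q :
  push phi (<< p >> - << q >>) = << phi p >> - << phi q >>.
Proof. by rewrite pushB; congr (_ - _); exact: pushU. Qed.

Lemma vdashUB d p q : (<< d >> : Di k X) ⊢ (<< p >> - << q >>)
  = << diword_vdash d p >> - << diword_vdash d q >>.
Proof. exact: etrans (bilinear_extUl _ _ _) (pushUB _ _ _). Qed.
Lemma vdashBU d p q : (<< p >> - << q >> : Di k X) ⊢ << d >>
  = << diword_vdash p d >> - << diword_vdash q d >>.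
Proof. exact: etrans (bilinear_extUr _ _ _) (pushUB _ _ _). Qed.
Lemma dashvUB d p q : (<< d >> : Di k X) ⊣ (<< p >> - << q >>)
  = << diword_dashv d p >> - << diword_dashv d q >>.
Proof. exact: etrans (bilinear_extUl _ _ _) (pushUB _ _ _). Qed.
Lemma dashvBU d p q : (<< p >> - << q >> : Di k X) ⊣ << d >>
  = << diword_dashv p d >> - << diword_dashv q d >>.
Proof. exact: etrans (bilinear_extUr _ _ _) (pushUB _ _ _). Qed.

Lemma mcoeffUB p q e :
  (<< p >> - << q >> : Di k X)@_e = (p == e)%:R - (q == e)%:R.
Proof. by rewrite mcoeffB; congr (_ - _); exact: mcoeffU. Qed.

Lemma diword_valE d : val d = (aword d, center d).
Proof. by rewrite /aword /center; case: (val d). Qed.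

Lemma diword_bounds d : (0 < center d <= size (aword d))%N.
Proof. by rewrite /aword /center; case: d => -[u m]. Qed.

Lemma diword_ex u m : (0 < m <= size u)%N -> exists d, val d = (u, m).
Proof. by move=> um; exists (@Diword X (u, m) um). Qed.

Lemma diwE d : diw k (aword d) (center d) = << d >>.
Proof. by rewrite /diw -diword_valE valK. Qed.

End Products.

Section Leading.
Variables (k : fieldType) (X : choiceType) (ltw : rel (seq X)).
Hypothesis mon : monomial_ordering ltw.
Implicit Types (p q d e : diword X) (f g h : Di k X) (u v w : seq X).
Local Notation lt := (diword_lt ltw).

Lemma ltw_ctx a b u v : u != [::] -> v != [::] -> ltw u v ->
  ltw (a ++ u ++ b) (a ++ v ++ b).
Proof.
case: mon => _ mono u0 v0 uv.
have uvb : ltw (u ++ b) (v ++ b).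
  case: b => [|x b]; first by rewrite !cats0.
  by have [] := mono v u (x :: b) v0 u0 isT uv.
case: a => // x a.
have [] // := mono (v ++ b) (u ++ b) (x :: a) _ _ isT uvb.
  by case: v v0 {uv uvb}.
by case: u u0 {uv uvb}.
Qed.

Lemma diword_lt_wf : well_founded (fun d e => lt d e).
Proof.
case: mon => -[_ _ _ wf] _.
(* Lexicographic induction: the outer one runs over nonempty words, the only ones on which [ltw] is
   well founded, the inner one over the center. *)
suff H (W : {u : seq X | u != [::]}) d : aword d = val W -> Acc (fun d e => lt d e) d.
  by move=> d; apply: (H (exist _ (aword d) (aword_neq0 d))).
elim/(well_founded_ind wf): W d => W IHW d.
have [n] := ubnP (center d); elim: n d => [d|n IHn d dn dW]; first by rewrite ltn0.
constructor=> e; rewrite /diword_lt => /orP[ed|/andP[/eqP ed cd]].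
  by apply: (IHW (exist _ (aword e) (aword_neq0 e))) => //; rewrite -dW.
by apply: IHn; [lia | rewrite ed].
Qed.

Lemma lt_neq p q : lt q p -> p != q.
Proof. by move=> qp; apply/eqP => e; rewrite e diword_lt_irr in qp. Qed.

Lemma msuppUB p q e : e \in msupp (<< p >> - << q >> : Di k X) -> e = p \/ e = q.
Proof.
rewrite -mcoeff_neq0 mcoeffUB.
case: (eqVneq p e) => [->|_]; first by left.
by case: (eqVneq q e) => [->|_]; [right|rewrite subr0 eqxx].
Qed.

Lemma mcoeffUBl p q : p != q -> (<< p >> - << q >> : Di k X)@_p = 1.
Proof. by move=> pq; rewrite mcoeffUB eqxx eq_sym (negbTE pq) subr0. Qed.

Lemma leadUB p q : lt q p -> lead ltw (<< p >> - << q >> : Di k X) = Some p.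
Proof.
move=> qp; apply: (lead_max mon).
  by rewrite -mcoeff_neq0 mcoeffUBl ?oner_eq0 ?lt_neq.
by move=> e /msuppUB[-> /eqP|->].
Qed.

Lemma leadU p : lead ltw (<< p >> : Di k X) = Some p.
Proof.
by apply: (lead_max mon) => [|e]; rewrite msuppU oner_eq0 inE // => ->.
Qed.

Lemma leadN f : lead ltw (- f) = lead ltw f.
Proof. by rewrite -scaleN1r leadZ // oppr_eq0 oner_eq0. Qed.

Lemma subUB_neq0 p q : p != q -> (<< p >> - << q >> : Di k X) != 0.
Proof.
move=> pq; apply/eqP => /(congr1 (mcoeff p)).
by rewrite (mcoeffUBl pq) mcoeff0 => /eqP; rewrite oner_eq0.
Qed.

Lemma restUB p q : lt q p ->
  rest ltw (<< p >> - << q >> : Di k X) = - << q >>.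
Proof.
move=> qp; have addBK (V : zmodType) (x y : V) : x - y - x = - y.
  by rewrite addrAC subrr add0r.
rewrite /rest /lead_term /lc (leadUB qp) (mcoeffUBl (lt_neq qp)).
exact: addBK.
Qed.

Lemma strongUB p q : lt q p ->
  strong ltw (<< p >> - << q >> : Di k X) = ltw (aword q) (aword p).
Proof.
move=> qp; rewrite /strong (restUB qp) (subUB_neq0 (lt_neq qp)) /lead_word.
by rewrite (leadUB qp) leadN leadU oppr_eq0 monalgU_eq0 oner_eq0.
Qed.

End Leading.

(** * Rewriting steps *)

Section Edges.
Variables (X : choiceType) (ltw : rel (seq X)).
Hypothesis mon : monomial_ordering ltw.
Implicit Types (p q d e P Q : diword X) (a b : seq X) (u : seq X).
Implicit Types (T : diword X -> diword X -> Prop).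
Local Notation lt := (diword_lt ltw).

Definition diword_le d e := (d == e) || lt d e.

Lemma diword_le_refl d : diword_le d d.
Proof. by rewrite /diword_le eqxx. Qed.

Lemma diword_le_lt_trans d e f : diword_le d e -> lt e f -> lt d f.
Proof. by case/orP=> [/eqP->//|]; apply: (diword_lt_trans mon). Qed.

Lemma diword_le_neq_lt d e : diword_le d e -> d <> e -> lt d e.
Proof. by case/orP => [/eqP|]. Qed.

(* The center [l] of [a p b] becomes the center [l'] of [a q b]. Strength of
   [p - q] is not required when [l] is outside [p]: if [p] and [q] have the same
   word, the two diwords then coincide. *)
Definition center_rel a p q (l l' : nat) : Prop :=
  [\/ (l <= size a)%N /\ l' = l,
      l = (size a + center p)%N /\ l' = (size a + center q)%N
    | (size a + size (aword p) < l)%N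
      /\ (l' + size (aword p) = l + size (aword q))%N].

Inductive edge T P Q : Prop :=
  Edge p q a b l l' of T p q & center_rel a p q l l'
    & val P = (a ++ aword p ++ b, l) & val Q = (a ++ aword q ++ b, l').

Lemma val_bounds d u l : val d = (u, l) -> (0 < l <= size u)%N.
Proof. by move=> E; have := diword_bounds d; rewrite /aword /center E. Qed.

Lemma val_aword d u l : val d = (u, l) -> aword d = u.
Proof. by rewrite /aword => ->. Qed.

Lemma val_center d u l : val d = (u, l) -> center d = l.
Proof. by rewrite /center => ->. Qed.

(** If the words of [p] and [q] differ, monotonicity in the context decides. If they agree, only a
    center inside [p] can move, and it moves down. *)
Lemma edge_le T P Q : (forall p q, T p q -> lt q p) ->
  edge T P Q -> diword_le Q P.
Proof.
move=> Tlt [p q a b l l' /Tlt qp c EP EQ].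
have := diword_bounds p; have := diword_bounds q => bq bp.
rewrite /diword_le /diword_lt (val_aword EP) (val_aword EQ).
rewrite (val_center EP) (val_center EQ).
case/orP: qp => [qp|/andP[/eqP wqp cqp]].
  by rewrite (ltw_ctx mon) ?orbT // aword_neq0.
rewrite wqp eqxx /=; have [l'l|/eqP ll'] := eqVneq l' l.
  by rewrite -val_eqE EP EQ wqp l'l eqxx.
suff -> : (l' < l)%N by rewrite !orbT.
by move: c cqp ll' => [[]|[]|[]]; rewrite ?wqp; lia.
Qed.

(** The position of the center selects the products: [⊣] with [a] on the left when it lies in [a],
    [⊢] with [b] on the right when it lies in [b], and otherwise [⊢] with [a] and [⊣] with [b].
    Empty contexts are treated apart, as no diword has an empty word. *)
Lemma edge_in_congruence T (R : diword X -> diword X -> Prop) P Q :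
  @is_congruence (free_disemigroup X) R -> (forall p q, T p q -> R p q) ->
  edge T P Q -> R P Q.
Proof.
move=> cR TR [p q a b l l' /TR pq c EP EQ].
have rfl := cong_refl cR.
have vd x x' y y' : R x x' -> R y y' -> R (diword_vdash x y) (diword_vdash x' y').
  exact: (cong_vdash cR).
have dv x x' y y' : R x x' -> R y y' -> R (diword_dashv x y) (diword_dashv x' y').
  exact: (cong_dashv cR).
have bp := diword_bounds p; have bq := diword_bounds q.
have := val_bounds EP; have := val_bounds EQ; rewrite !size_cat => bQ bP.
have mid x y : R x y -> forall x' y', val x' = (aword x ++ b, center x) ->
    val y' = (aword y ++ b, center y) -> R x' y'.
  move=> xy x' y' Ex Ey; case: (posnP (size b)) => [/size0nil b0|b0].
    by move: Ex Ey; rewrite b0 !cats0 -!diword_valE => /val_inj-> /val_inj->.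
  have [B EB] := @diword_ex X b 1 b0.
  have -> : x' = diword_dashv x B.
    by apply: val_inj; rewrite Ex /= (val_aword EB).
  have -> : y' = diword_dashv y B.
    by apply: val_inj; rewrite Ey /= (val_aword EB).
  exact: dv.
have left m x y : (0 < m <= size a)%N -> val x = (a ++ aword p, m) ->
    val y = (a ++ aword q, m) -> R x y.
  move=> /diword_ex[A EA] Ex Ey.
  have -> : x = diword_dashv A p.
    by apply: val_inj; rewrite Ex /= (val_aword EA) (val_center EA).
  have -> : y = diword_dashv A q.
    by apply: val_inj; rewrite Ey /= (val_aword EA) (val_center EA).
  exact: dv.
have right x y : val x = (a ++ aword p, size a + center p)%N ->
    val y = (a ++ aword q, size a + center q)%N -> R x y.
  move=> Ex Ey; case: (posnP (size a)) => [/size0nil a0|a0].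
    by move: Ex Ey; rewrite a0 /= -!diword_valE => /val_inj-> /val_inj->.
  have [|A EA] := @diword_ex X a (size a); first by rewrite a0 leqnn.
  have -> : x = diword_vdash A p.
    by apply: val_inj; rewrite Ex /= (val_aword EA).
  have -> : y = diword_vdash A q.
    by apply: val_inj; rewrite Ey /= (val_aword EA).
  exact: vd.
case: c => [[la l'l]|[lE l'E]|[lp l'E]].
- have la0 : (0 < l <= size a)%N by lia.
  have [|x Ex] := @diword_ex X (a ++ aword p) l; first by rewrite size_cat; lia.
  have [|y Ey] := @diword_ex X (a ++ aword q) l; first by rewrite size_cat; lia.
  apply: (mid x y (left l x y la0 Ex Ey)).
    by rewrite (val_aword Ex) (val_center Ex) EP catA.
  by rewrite (val_aword Ey) (val_center Ey) EQ l'l catA.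
- have [|x Ex] := @diword_ex X (a ++ aword p) (size a + center p).
    by rewrite size_cat; lia.
  have [|y Ey] := @diword_ex X (a ++ aword q) (size a + center q).
    by rewrite size_cat; lia.
  apply: (mid x y (right x y Ex Ey)).
    by rewrite (val_aword Ex) (val_center Ex) EP lE catA.
  by rewrite (val_aword Ey) (val_center Ey) EQ l'E catA.
- have [|x Ex] := @diword_ex X (a ++ aword p) (size a + center p).
    by rewrite size_cat; lia.
  have [|y Ey] := @diword_ex X (a ++ aword q) (size a + center q).
    by rewrite size_cat; lia.
  have [|B EB] := @diword_ex X b (l - size a - size (aword p)); first by lia.
  have -> : P = diword_vdash x B.
    apply: val_inj; rewrite EP /= (val_aword EB) (val_center EB) (val_aword Ex).
    by rewrite catA size_cat; congr (_, _); lia.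
  have -> : Q = diword_vdash y B.
    apply: val_inj; rewrite EQ /= (val_aword EB) (val_center EB) (val_aword Ey).
    by rewrite catA size_cat; congr (_, _); lia.
  by apply: vd => //; apply: right.
Qed.

(* [plug a b n l d] puts [d] in the place of a factor of length [n] of a diword
   [a _ b] with center [l]; a center inside that factor moves to that of [d]. *)
Definition plug_center a n (l : nat) d : nat :=
  if (l <= size a)%N then l
  else if (l <= size a + n)%N then (size a + center d)%N
  else (l - n + size (aword d))%N.

Definition plug a b n l d : diword X :=
  insubd d (a ++ aword d ++ b, plug_center a n l d).

(** The bound on [l] makes the pair a valid diword, so the default value of [insubd] is never
    taken. *)
Lemma val_plug a b n l d : (0 < l <= size a + n + size b)%N ->
  val (plug a b n l d) = (a ++ aword d ++ b, plug_center a n l d).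
Proof.
move=> lb; rewrite /plug val_insubd /=; case: ifP => // /negP[].
have := diword_bounds d; rewrite !size_cat /plug_center.
by case: ifP => ?; [|case: ifP => ?]; lia.
Qed.

Lemma plug_le a b n l d e : (0 < l <= size a + n + size b)%N ->
  diword_le d e -> diword_le (plug a b n l d) (plug a b n l e).
Proof.
move=> lb /orP[/eqP->|]; first exact: diword_le_refl.
rewrite /diword_le -val_eqE /diword_lt /aword /center !val_plug //=.
rewrite -/(aword d) -/(aword e) -/(center d) -/(center e).
case/orP=> [de|/andP[/eqP wde cde]].
  by rewrite (ltw_ctx mon) ?orbT // aword_neq0.
rewrite wde eqxx /=; have [E|ne] := eqVneq (plug_center a n l d) (plug_center a n l e).
  by rewrite E eqxx.
suff -> : (plug_center a n l d < plug_center a n l e)%N by rewrite !orbT.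
move: ne; rewrite /plug_center wde; case: ifP => ?; first by rewrite eqxx.
by case: ifP => ?; [lia|rewrite eqxx].
Qed.

(** Contexts compose. A center outside the factor falls under the first or third case of
    [center_rel]; one inside inherits the case of the given step. *)
Lemma plug_edge T a b n l P Q : (0 < l <= size a + n + size b)%N ->
  edge T P Q -> edge T (plug a b n l P) (plug a b n l Q).
Proof.
move=> lb [p q a' b' m m' pq c EP EQ].
apply: (@Edge T _ _ p q (a ++ a') (b' ++ b)
  (plug_center a n l P) (plug_center a n l Q)) => //.
- have := val_bounds EP; have := val_bounds EQ.
  rewrite /plug_center (val_aword EP) (val_aword EQ) (val_center EP) (val_center EQ).
  have bp := diword_bounds p; have bq := diword_bounds q.
  rewrite /center_rel !size_cat => bP bQ.
  case: ifP => la; first by apply: Or31; lia.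
  case: ifP => ln; last by apply: Or33; lia.
  by case: c => [[]|[]|[]] *; [apply: Or31|apply: Or32|apply: Or33]; lia.
- by rewrite val_plug // (val_aword EP) !catA.
- by rewrite val_plug // (val_aword EQ) !catA.
Qed.

(** The bound refers to the two ends and not to a peak above them: this is what triviality of a
    composition provides. When both ends lie below [w], it yields connectedness strictly below
    [w]. *)
Definition linked T (u v : diword X) := clos_refl_sym_trans (diword X)
  (fun P Q => edge T P Q /\ (diword_le P u \/ diword_le P v)) u v.

Lemma linked_sym T (u v : diword X) : linked T u v -> linked T v u.
Proof.
(* The bound mentions [u] and [v], so it is kept fixed while the end points of the path vary. *)
suff H x y : clos_refl_sym_trans (diword X)
    (fun P Q => edge T P Q /\ (diword_le P u \/ diword_le P v)) x y ->
  clos_refl_sym_trans (diword X)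
    (fun P Q => edge T P Q /\ (diword_le P v \/ diword_le P u)) x y.
  by move=> uv; apply: rst_sym; apply: H.
elim=> [P Q [PQ bP]|P|P Q _|P Q R _ PQ _]; first 1 last.
- exact: rst_refl.
- exact: rst_sym.
- exact: rst_trans.
by apply: rst_step; split=> //; case: bP; [right|left].
Qed.

Lemma linked_plug T a b n l (u v : diword X) : (0 < l <= size a + n + size b)%N ->
  linked T u v -> linked T (plug a b n l u) (plug a b n l v).
Proof.
move=> lb; rewrite /linked; set B := (X in clos_refl_sym_trans _ X u v).
set B' := (X in _ -> clos_refl_sym_trans _ X _ _).
elim=> [P Q [PQ bP]|P|P Q _|P Q R _ PQ _]; first 1 last.
- exact: rst_refl.
- exact: rst_sym.
- exact: rst_trans.
apply: rst_step; split; first exact: plug_edge.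
by case: bP => bP; [left|right]; apply: plug_le.
Qed.

Lemma linked_join T (u v z : diword X) : edge T u z -> edge T v z -> linked T u v.
Proof.
move=> uz vz; apply: (@rst_trans _ _ _ z); last apply: rst_sym.
  by apply: rst_step; split=> //; left; apply: diword_le_refl.
by apply: rst_step; split=> //; right; apply: diword_le_refl.
Qed.

End Edges.

(** * Compositions of binomials *)

Section BinomialDiwords.
Variables (k : fieldType) (X : choiceType) (ltw : rel (seq X)).
Hypothesis mon : monomial_ordering ltw.
Implicit Types (p q d e P Q U V : diword X) (a b u : seq X).
Implicit Types (T : diword X -> diword X -> Prop) (G : Di k X -> Prop).
Local Notation lt := (diword_lt ltw).
Local Notation binom p q := (<< p >> - << q >> : Di k X).

Lemma diw_val d u m : val d = (u, m) -> diw k u m = << d >>.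
Proof. by move=> E; rewrite -(diwE k d) (val_aword E) (val_center E). Qed.

Lemma dashv_wordUB p q b : exists P Q,
  [/\ val P = (aword p ++ b, center p), val Q = (aword q ++ b, center q)
    & dashv_word (binom p q) b = binom P Q].
Proof.
case: b => [|x b]; first by exists p, q; rewrite !cats0 -!diword_valE.
have [//|B EB] := @diword_ex X (x :: b) 1.
exists (diword_dashv p B), (diword_dashv q B).
by rewrite /dashv_word (diw_val EB) dashvBU /= (val_aword EB).
Qed.

Lemma vdash_wordUB p q a : exists P Q,
  [/\ val P = (a ++ aword p, size a + center p)%N,
      val Q = (a ++ aword q, size a + center q)%N
    & vdash_word a (binom p q) = binom P Q].
Proof.
case: a => [|x a]; first by exists p, q; rewrite -!diword_valE.
have [|A EA] := @diword_ex X (x :: a) (size (x :: a)); first by rewrite leqnn.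
exists (diword_vdash A p), (diword_vdash A q).
by rewrite /vdash_word (diw_val EA) vdashUB /= (val_aword EA).
Qed.

Lemma lead_centerUB f p q : f = binom p q -> lt q p ->
  lead_center ltw f = center p.
Proof. by move=> -> qp; rewrite /lead_center (leadUB k mon qp). Qed.

Lemma lead_wordUB f p q : f = binom p q -> lt q p -> lead_word ltw f = aword p.
Proof. by move=> -> qp; rewrite /lead_word (leadUB k mon qp). Qed.

Lemma strong_wordUB f p q : f = binom p q -> lt q p ->
  strong ltw f = ltw (aword q) (aword p).
Proof. by move=> -> qp; rewrite (strongUB k mon qp). Qed.

Lemma centersUB a b f p q m : f = binom p q -> lt q p ->
  (m \in centers ltw a f b) =
  (m == size a + center p)%N || ltw (aword q) (aword p) && ((1 <= m <= size a)
    || (size a + size (aword p) < m <= size a + size (aword p) + size b))%N.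
Proof.
move=> fE qp; rewrite unfold_in /centers.
rewrite (lead_centerUB fE qp) (lead_wordUB fE qp) (strong_wordUB fE qp).
by rewrite !size_cat addnA.
Qed.

(** All factors are basis diwords, so the result is again a binomial; the three branches of
    [sdiword] are the three cases of [center_rel]. *)
Lemma sdiwordUB a b f p q m : f = binom p q -> lt q p ->
  m \in centers ltw a f b ->
  exists P Q m', [/\ val P = (a ++ aword p ++ b, m), val Q = (a ++ aword q ++ b, m'),
    center_rel a p q m m' & sdiword ltw a f b m = binom P Q].
Proof.
move=> fE qp; rewrite (centersUB _ _ _ fE qp) /sdiword.
rewrite (lead_centerUB fE qp) (lead_wordUB fE qp) {}fE.
have bp := diword_bounds p; have bq := diword_bounds q.
move=> mc; have [ma|am] := leqP m (size a).
  have [|A EA] := @diword_ex X a m; first by lia.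
  have wA d : aword (diword_dashv A d) = a ++ aword d by rewrite -(val_aword EA).
  have cA d : center (diword_dashv A d) = m by rewrite -(val_center EA).
  rewrite (diw_val EA) dashvUB.
  have [P [Q [EP EQ ->]]] := dashv_wordUB (diword_dashv A p) (diword_dashv A q) b.
  exists P, Q, m; rewrite EP EQ !wA !cA !catA; split=> //.
  by apply: Or31.
have [P0 [Q0 [EP0 EQ0 ->]]] := vdash_wordUB p q a.
have [mE|mE] := eqVneq m (size a + center p)%N.
  have [P [Q [EP EQ ->]]] := dashv_wordUB P0 Q0 b.
  exists P, Q, (size a + center q)%N; rewrite EP EQ (val_aword EP0) (val_aword EQ0).
  rewrite (val_center EP0) (val_center EQ0) mE !catA; split=> //.
  by apply: Or32.
(* Here [m] is past [a] and is not the leading center, so membership in [centers] puts it beyond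
   [p], and the shifted position is valid in [b]. *)
have [|B EB] := @diword_ex X b (m - size (a ++ aword p)); first by rewrite size_cat; lia.
rewrite (diw_val EB) vdashBU; exists (diword_vdash P0 B), (diword_vdash Q0 B),
  (m - size (aword p) + size (aword q))%N.
rewrite /= (val_aword EB) (val_center EB) (val_aword EP0) (val_aword EQ0) !catA !size_cat.
split=> //; [congr (_, _)|congr (_, _)|apply: Or33]; lia.
Qed.

Lemma lead0 : lead ltw (0 : Di k X) = None.
Proof. by rewrite /lead msupp0. Qed.

Lemma binomC p q : binom p q = - binom q p.
Proof. by rewrite opprB. Qed.

(** If [V] were outside the component of [U], the linear form [ev] extending the indicator [chi] of
    that component would be 1 on [U - V]. Yet it vanishes on every summand [P - Q], whose two
    diwords lie in one component. *)
Lemma trivial_linked T U V h : (forall p q, T p q -> lt q p) ->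
  h = binom U V -> trivial_mod ltw (binomials k T) h -> linked ltw T U V.
Proof.
move=> Tlt hUV [n [al [a [b [s [m [H hE]]]]]]].
rewrite /linked; set E := (X in clos_refl_sym_trans _ X).
have [->|neq] := eqVneq U V; first exact: rst_refl.
have [//|nUV] := classic (clos_refl_sym_trans (diword X) E U V).
pose chi d : k := if excluded_middle_informative
  (clos_refl_sym_trans (diword X) E U d) then 1 else 0.
have chiE d e : clos_refl_sym_trans (diword X) E d e -> chi d = chi e.
  move=> de; rewrite /chi; case: excluded_middle_informative => ud;
    case: excluded_middle_informative => ue //.
    by case: ue; apply: rst_trans ud de.
  by case: ud; apply: rst_trans ue _; apply: rst_sym.
have chiU : chi U = 1.
  by rewrite /chi; case: excluded_middle_informative => // -[]; apply: rst_refl.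
have chiV : chi V = 0 by rewrite /chi; case: excluded_middle_informative.
pose ev (f : Di k X) : k := mmap idfun chi f.
have evB p q : ev (binom p q) = chi p - chi q.
  by rewrite /ev mmapB; congr (_ - _); rewrite mmapU /= mul1r.
have evZ c f : ev (c *: f) = c * ev f.
  rewrite /ev (mmapEw (msuppZ_le c f)) mmapE mulr_sumr.
  by apply: eq_bigr => d _; rewrite mcoeffZ mulrA.
have ev_sum (F : 'I_n -> Di k X) : ev (\sum_i F i) = \sum_i ev (F i).
  exact: (raddf_sum (mmap idfun chi)).
have leadh : lead ltw h = Some U \/ lead ltw h = Some V.
  case/orP: (diword_lt_total mon neq) => lUV.
    by right; rewrite hUV binomC leadN (leadUB k mon lUV).
  by left; rewrite hUV (leadUB k mon lUV).
have : ev h = 0.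
  rewrite hE ev_sum big1 // => i _.
  have [[p [q [Tpq sE]]] mc ll] := H i.
  have [P [Q [m' [EP EQ c sdE]]]] := sdiwordUB sE (Tlt _ _ Tpq) mc.
  have ePQ : edge T P Q by apply: Edge Tpq c EP EQ.
  rewrite evZ sdE evB (_ : chi P = chi Q) ?subrr ?mulr0 //.
  case/orP: (edge_le mon Tlt ePQ) => [/eqP->//|QP].
  (* The leading diword of the summand is [P], and that of [h] is [U] or [V]; the bound in
     [trivial_mod] is thus the one required of an admissible step. *)
  apply: chiE; apply: rst_step; split=> //.
  move: ll; rewrite sdE (leadUB k mon QP).
  by case: leadh => ->; [left|right].
by rewrite hUV evB chiU chiV subr0 => /eqP; rewrite oner_eq0.
Qed.

(** The word and the center determine the leading diword [P], so it cancels and only the two reducts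
    remain. *)
Lemma sdiwordB T f g p1 q1 p2 q2 a1 b1 a2 b2 m :
  (forall p q, T p q -> lt q p) ->
  f = binom p1 q1 -> g = binom p2 q2 -> T p1 q1 -> T p2 q2 ->
  a1 ++ aword p1 ++ b1 = a2 ++ aword p2 ++ b2 ->
  m \in centers ltw a1 f b1 -> m \in centers ltw a2 g b2 ->
  exists P Q1 Q2 m1 m2, [/\ edge T P Q1, edge T P Q2,
    val Q1 = (a1 ++ aword q1 ++ b1, m1) /\ center_rel a1 p1 q1 m m1,
    val Q2 = (a2 ++ aword q2 ++ b2, m2) /\ center_rel a2 p2 q2 m m2 &
    sdiword ltw a1 f b1 m - sdiword ltw a2 g b2 m = binom Q2 Q1].
Proof.
move=> Tlt fE gE T1 T2 W mc1 mc2.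
have [P [Q1 [m1 [EP EQ1 c1 ->]]]] := sdiwordUB fE (Tlt _ _ T1) mc1.
have [P' [Q2 [m2 [EP' EQ2 c2 ->]]]] := sdiwordUB gE (Tlt _ _ T2) mc2.
have PP : P' = P by apply: val_inj; rewrite EP EP' W.
have cancel3 (V : zmodType) (x y z : V) : (x - y) - (x - z) = z - y.
  by rewrite opprB addrC addrA subrK.
exists P, Q1, Q2, m1, m2; rewrite PP; split; [| |by []|by []|exact: cancel3].
  exact: Edge T1 c1 EP EQ1.
by apply: Edge T2 c2 _ EQ2; rewrite -PP.
Qed.

Lemma sdiword_nil f p q : f = binom p q -> lt q p ->
  sdiword ltw [::] f [::] (lead_center ltw f) = f.
Proof.
by move=> fE qp; apply: (sdiword0 mon); rewrite fE; apply: subUB_neq0 (lt_neq mon qp).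
Qed.

(* A binomial that is not strong has a single associative word, so the
   one-sided compositions [comp_left] and [comp_right] vanish. *)
Lemma composition_in_congruence T (R : diword X -> diword X -> Prop) G h :
  @is_congruence (free_disemigroup X) R -> (forall p q, T p q -> R p q) ->
  (forall p q, T p q -> lt q p) -> (forall f, G f -> binomials k T f) ->
  composition ltw G h -> exists U V, h = binom U V /\ R U V.
Proof.
move=> cR TR Tlt GT; have rfl := cong_refl cR.
(* Covers all the other compositions: both reducts are congruent to the common leading diword. *)
have two f g a1 b1 a2 b2 m : G f -> G g ->
    a1 ++ lead_word ltw f ++ b1 = a2 ++ lead_word ltw g ++ b2 ->
    m \in centers ltw a1 f b1 -> m \in centers ltw a2 g b2 ->
    exists U V, sdiword ltw a1 f b1 m - sdiword ltw a2 g b2 m = binom U V /\ R U V.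
  move=> /GT[p1 [q1 [T1 fE]]] /GT[p2 [q2 [T2 gE]]].
  rewrite (lead_wordUB fE (Tlt _ _ T1)) (lead_wordUB gE (Tlt _ _ T2)) => W mc1 mc2.
  have [P [Q1 [Q2 [m1 [m2 [e1 e2 _ _ ->]]]]]] := sdiwordB Tlt fE gE T1 T2 W mc1 mc2.
  exists Q2, Q1; split; first exact: erefl.
  have r1 := edge_in_congruence cR TR e1; have r2 := edge_in_congruence cR TR e2.
  exact: (cong_trans cR (cong_sym cR r2) r1).
have centerE f b : lead_center ltw f \in centers ltw [::] f b.
  by rewrite unfold_in /centers eqxx.
have strong_centers f a b m : strong ltw f -> ((1 <= m <= size a)
      || (size (a ++ lead_word ltw f) < m <= size (a ++ lead_word ltw f ++ b)))%N ->
    m \in centers ltw a f b.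
  by move=> sf mab; rewrite unfold_in /centers sf mab orbT.
have weak f : G f -> ~~ strong ltw f ->
    exists p q, f = binom p q /\ aword p = aword q.
  move=> /GT[p [q [Tpq fE]]]; have qp := Tlt _ _ Tpq.
  rewrite (strong_wordUB fE qp) => s; exists p, q; split=> //.
  by move: qp s; rewrite /diword_lt => /orP[->//|/andP[/eqP-> _]].
case.
- move=> f x Gf /(weak _ Gf)[p [q [-> wpq]]].
  have [//|A EA] := @diword_ex X [:: x] 1.
  rewrite (diw_val EA) dashvUB; exists (diword_dashv A p), (diword_dashv A q).
  rewrite (_ : diword_dashv A q = diword_dashv A p); first by split; [exact: erefl|exact: rfl].
  by apply: val_inj; rewrite /= wpq.
- move=> f u Gf /(weak _ Gf)[p [q [-> wpq]]] u0.
  have [|A EA] := @diword_ex X u (size u); first by rewrite leqnn lt0n size_eq0 u0.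
  rewrite (diw_val EA) vdashBU; exists (diword_vdash p A), (diword_vdash q A).
  rewrite (_ : diword_vdash q A = diword_vdash p A); first by split; [exact: erefl|exact: rfl].
  by apply: val_inj; rewrite /= wpq.
- move=> f g a b Gf Gg W mc; have [p [q [Tpq fE]]] := GT _ Gf.
  (* In an inclusion, [f] itself is read as the normal diword with empty context. *)
  rewrite -{1}(sdiword_nil fE (Tlt _ _ Tpq)).
  by apply: two => //; rewrite cats0.
- move=> f g a b x Gf Gg W _ sf sg.
  by apply: two => //; [rewrite W cats0|apply: strong_centers..].
- move=> f g a b x Gf Gg W _ sf sg; apply: two => //; first by rewrite W -!cats1 !catA.
    by apply: strong_centers => //; rewrite /= size_cat /=; lia.
  by apply: strong_centers => //; rewrite W !size_cat size_rcons; lia.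
- move=> f g a b m Gf Gg W _ mf mg.
  by apply: two => //; rewrite cats0.
- move=> f g a b x Gf Gg W _ _ sf sg.
  by apply: two => //; [rewrite /= W cats0|apply: strong_centers..].
- move=> f g a b x Gf Gg W _ _ sf sg; apply: two => //.
  + by rewrite /= -cats1 catA W -catA.
  + by apply: strong_centers => //; rewrite /= !size_cat size_rcons; lia.
  by apply: strong_centers => //; rewrite W !size_cat /=; lia.
Qed.

Lemma lcUB p q : lt q p -> lc ltw (binom p q) = 1.
Proof. by move=> qp; rewrite /lc (leadUB k mon qp) (mcoeffUBl k (lt_neq mon qp)). Qed.

Lemma lcN (f : Di k X) : lc ltw (- f) = - lc ltw f.
Proof. by rewrite /lc leadN; case: lead => [d|]; rewrite ?mcoeffN ?oppr0. Qed.

(** Induction on the stage. A new nontrivial composition is a difference of two distinct congruent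
    diwords; its leading coefficient is 1 or -1, so making it monic merely orients it. *)
Lemma shirshov_binomials S f :
  (forall p q, S p q -> lt q p) -> shirshov ltw (binomials k S) f ->
  binomials k (fun p q => lt q p /\ congruence_gen (D := free_disemigroup X) S p q) f.
Proof.
set T := fun _ _ => _ /\ _ => Slt [n]; elim: n f => [|n IH] f /=.
  move=> [p [q [Spq ->]]]; exists p, q; split=> //; split; first exact: Slt.
  by move=> R _; apply.
case=> [/IH//|[h [ch nt ->]]]; have h0 := nontrivial_neq0 nt.
have [||U [V [hE RUV]]] := composition_in_congruence
  (congruence_genP (D := free_disemigroup X) S) _ _ IH ch.
- by move=> p q [].
- by move=> p q [].
have neq : U != V by apply: contraNneq h0 => e; rewrite hE e subrr.
case/orP: (diword_lt_total mon neq) => lUV; last first.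
  by exists U, V; rewrite hE (lcUB lUV) invr1 scale1r.
exists V, U; rewrite (etrans hE (binomC U V)) lcN (lcUB lUV) invrN invr1 scaleN1r; split.
  by split=> //; exact: (cong_sym (congruence_genP (D := free_disemigroup X) S) RUV).
exact: opprK.
Qed.

End BinomialDiwords.

(** * Confluence *)

Section CriticalPairs.
Variables (k : fieldType) (X : choiceType) (ltw : rel (seq X)).
Hypothesis mon : monomial_ordering ltw.
Variables (G : Di k X -> Prop) (T : diword X -> diword X -> Prop).
Implicit Types (p q d e P Q u v w z : diword X) (a b : seq X).
Local Notation lt := (diword_lt ltw).
Local Notation binom p q := (<< p >> - << q >> : Di k X).
Hypothesis Tlt : forall p q, T p q -> lt q p.
Hypothesis GT : forall f, G f -> binomials k T f.
Hypothesis TG : forall p q, T p q -> G (binom p q).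
Hypothesis GS : GS_basis ltw G.

(** The passage from the Gröbner-Shirshov property to rewriting: triviality of the composition joins
    the two reducts. *)
Lemma composition_linked f g p1 q1 p2 q2 a1 b1 a2 b2 m :
  f = binom p1 q1 -> g = binom p2 q2 -> T p1 q1 -> T p2 q2 ->
  a1 ++ aword p1 ++ b1 = a2 ++ aword p2 ++ b2 ->
  m \in centers ltw a1 f b1 -> m \in centers ltw a2 g b2 ->
  composition ltw G (sdiword ltw a1 f b1 m - sdiword ltw a2 g b2 m) ->
  exists Q1 Q2 m1 m2, [/\ val Q1 = (a1 ++ aword q1 ++ b1, m1),
    val Q2 = (a2 ++ aword q2 ++ b2, m2), center_rel a1 p1 q1 m m1,
    center_rel a2 p2 q2 m m2 & linked ltw T Q1 Q2].
Proof.
move=> fE gE T1 T2 W mc1 mc2 /(proj2 GS)/(trivial_sub GT).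
have [P [Q1 [Q2 [m1 [m2 [_ _ [EQ1 c1] [EQ2 c2] hE]]]]]] :=
  sdiwordB mon Tlt fE gE T1 T2 W mc1 mc2.
move=> tr; exists Q1, Q2, m1, m2; split=> //.
exact: linked_sym (trivial_linked mon Tlt hE tr).
Qed.

(** Treats inclusions ([b1] empty) and proper intersections ([b2] empty) uniformly, so that critical
    pairs need no separate discussion of the two. *)
Lemma overlap_composition f g p1 q1 p2 q2 a b1 b2 :
  f = binom p1 q1 -> g = binom p2 q2 -> T p1 q1 -> T p2 q2 ->
  aword p1 ++ b1 = a ++ aword p2 ++ b2 ->
  b1 = [::] \/ b2 = [::] /\ (size b1 < size (aword p2))%N ->
  (forall m, m \in centers ltw [::] f b1 -> m \in centers ltw a g b2 ->
    composition ltw G (sdiword ltw [::] f b1 m - sdiword ltw a g b2 m)) /\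
  ((forall m, ~~ ((m \in centers ltw [::] f b1) && (m \in centers ltw a g b2))) ->
    strong ltw f -> strong ltw g -> forall x,
    composition ltw G (sdiword ltw [:: x] f b1 1 - sdiword ltw (x :: a) g b2 1) /\
    composition ltw G
      (sdiword ltw [::] f (rcons b1 x) (size (aword p1 ++ b1)).+1
       - sdiword ltw a g (rcons b2 x) (size (aword p1 ++ b1)).+1)).
Proof.
move=> fE gE T1 T2; have lt1 := Tlt T1; have lt2 := Tlt T2.
have Gf : G f by rewrite fE; apply: TG.
have Gg : G g by rewrite gE; apply: TG.
have wf := lead_wordUB mon fE lt1; have wg := lead_wordUB mon gE lt2.
rewrite -wf -wg => W; case=> [b1E|[b2E sb]].
  move: W; rewrite b1E cats0 => W.
  (* With empty context the only admissible center of [f] is its leading one, so the existence of a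
     common center becomes the side condition of an inclusion. *)
  have mf m : (m \in centers ltw [::] f [::]) = (m == lead_center ltw f).
    rewrite (centersUB mon _ _ _ fE lt1) (lead_centerUB mon fE lt1) /=; lia.
  split=> [m|nc sf sg x].
    rewrite mf => /eqP-> mg; rewrite (sdiword_nil mon fE lt1).
    exact: comp_incl.
  have mg : lead_center ltw f \notin centers ltw a g b2.
    by have := nc (lead_center ltw f); rewrite mf eqxx.
  by split; [exact: comp_incl_left|exact: comp_incl_right].
move: W; rewrite b2E cats0 => W.
have s : (size (lead_word ltw f ++ b1) < size (lead_word ltw f) + size (lead_word ltw g))%N.
  by rewrite size_cat ltn_add2l.
split=> [m mf mg|nc sf sg x]; first exact: comp_inter.
by split; [exact: comp_inter_left|exact: comp_inter_right].
Qed.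

(** With equal words, a step whose center is outside [p] would leave the diword unchanged. *)
Lemma proper_edge_strong p q a b l l' u w : T p q -> center_rel a p q l l' ->
  val w = (a ++ aword p ++ b, l) -> val u = (a ++ aword q ++ b, l') -> u <> w ->
  l <> (size a + center p)%N -> ltw (aword q) (aword p).
Proof.
move=> /Tlt; rewrite /diword_lt => /orP[//|/andP[/eqP wqp _]] c Ew Eu uw lc.
by case: uw; apply: val_inj; rewrite Ew Eu wqp; case: c => [[]|[]|[]];
  rewrite ?wqp => *; congr (_, _); lia.
Qed.

(* With [W] the overlap word and [l] the center of [A W B]: if [l] is inside [W]
   or the two diwords share a center, their composition is placed between [A]
   and [B]; otherwise [l] is in [A] or in [B], both polynomials are strong, and
   the composition that extends [W] by the adjacent letter of [A] or [B]
   applies. *)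
Lemma critical_overlap A B p1 q1 b1 a p2 q2 b2 l l1 l2 w u v :
  T p1 q1 -> T p2 q2 -> aword p1 ++ b1 = a ++ aword p2 ++ b2 ->
  b1 = [::] \/ b2 = [::] /\ (size b1 < size (aword p2))%N ->
  center_rel A p1 q1 l l1 -> center_rel (A ++ a) p2 q2 l l2 ->
  val w = (A ++ (aword p1 ++ b1) ++ B, l) ->
  val u = (A ++ (aword q1 ++ b1) ++ B, l1) ->
  val v = (A ++ (a ++ aword q2 ++ b2) ++ B, l2) ->
  u <> w -> v <> w -> linked ltw T u v.
Proof.
move=> T1 T2 W ov c1 c2 Ew Eu Ev uw vw.
have [f fE] : exists f, f = binom p1 q1 := ex_intro _ _ erefl.
have [g gE] : exists g, g = binom p2 q2 := ex_intro _ _ erefl.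
have [K1 K2] := overlap_composition fE gE T1 T2 W ov.
have bw := val_bounds Ew; rewrite !size_cat in bw.
have sW := congr1 size W; rewrite !size_cat in sW.
have lt1 := Tlt T1; have lt2 := Tlt T2.
have bp1 := diword_bounds p1; have bq1 := diword_bounds q1.
have bp2 := diword_bounds p2; have bq2 := diword_bounds q2.
have st1 : l <> (size A + center p1)%N -> ltw (aword q1) (aword p1).
  by apply: (@proper_edge_strong _ _ _ (b1 ++ B) _ _ u w T1 c1); rewrite ?Ew ?Eu -?catA.
have st2 : l <> (size (A ++ a) + center p2)%N -> ltw (aword q2) (aword p2).
  by apply: (@proper_edge_strong _ _ _ (b2 ++ B) _ _ v w T2 c2); rewrite ?Ew ?Ev ?W -?catA.
(* The common end of all cases: [n] is the length of the composition word, [A'] and [B'] are what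
   remains of the context, and the last two premises compare centers. *)
have plugs A' B' n a1' b1' a2' b2' m : (0 < l <= size A' + n + size B')%N ->
    a1' ++ aword p1 ++ b1' = a2' ++ aword p2 ++ b2' ->
    m \in centers ltw a1' f b1' -> m \in centers ltw a2' g b2' ->
    composition ltw G (sdiword ltw a1' f b1' m - sdiword ltw a2' g b2' m) ->
    A' ++ a1' = A -> b1' ++ B' = b1 ++ B ->
    A' ++ a2' = A ++ a -> b2' ++ B' = b2 ++ B ->
    (forall Q m1, center_rel a1' p1 q1 m m1 -> center Q = m1 ->
      aword Q = a1' ++ aword q1 ++ b1' -> plug_center A' n l Q = l1) ->
    (forall Q m2, center_rel a2' p2 q2 m m2 -> center Q = m2 ->
      aword Q = a2' ++ aword q2 ++ b2' -> plug_center A' n l Q = l2) ->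
    linked ltw T u v.
  move=> bl W' m1c m2c cmp eA1 eB1 eA2 eB2 pc1 pc2.
  have [Q1 [Q2 [m1 [m2 [EQ1 EQ2 cr1 cr2 lk]]]]] :=
    composition_linked fE gE T1 T2 W' m1c m2c cmp.
  have -> : u = plug A' B' n l Q1.
    apply: val_inj; rewrite val_plug // Eu (val_aword EQ1).
    rewrite (pc1 _ _ cr1 (val_center EQ1) (val_aword EQ1)).
    by rewrite -!catA eB1 -eA1 -!catA.
  have -> : v = plug A' B' n l Q2.
    apply: val_inj; rewrite val_plug // Ev (val_aword EQ2).
    rewrite (pc2 _ _ cr2 (val_center EQ2) (val_aword EQ2)).
    by rewrite -!catA eB2 [A' ++ _]catA eA2 -!catA.
  exact: (linked_plug mon).
rewrite !size_cat in st2.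
have bQ1 Q a' b' : aword Q = a' ++ aword q1 ++ b' ->
    size (aword Q) = (size a' + size (aword q1) + size b')%N.
  by move=> ->; rewrite !size_cat addnA.
have bQ2 Q a' b' : aword Q = a' ++ aword q2 ++ b' ->
    size (aword Q) = (size a' + size (aword q2) + size b')%N.
  by move=> ->; rewrite !size_cat addnA.
have mcE1 a' b' := centersUB mon a' b' _ fE lt1.
have mcE2 a' b' := centersUB mon a' b' _ gE lt2.
have common : (exists m, (m \in centers ltw [::] f b1) && (m \in centers ltw a g b2))
    \/ (forall m, ~~ ((m \in centers ltw [::] f b1) && (m \in centers ltw a g b2))).
  have [|nc] := classic (exists m,
    (m \in centers ltw [::] f b1) && (m \in centers ltw a g b2)); [by left|right=> m].
  by apply/negP => mm; apply: nc; exists m.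
have sf := strong_wordUB mon fE lt1; have sg := strong_wordUB mon gE lt2.
have [lA|Al] := leqP l (size A).
  have s1 : ltw (aword q1) (aword p1) by apply: st1; clear -lA bp1; lia.
  have s2 : ltw (aword q2) (aword p2) by apply: st2; clear -lA bp2; lia.
  have l1E : l1 = l by clear -c1 lA bp1; case: c1 => [[]|[]|[]]; lia.
  have l2E : l2 = l by clear -c2 lA bp2; case: c2 => [[]|[]|[]]; rewrite size_cat; lia.
  (* As [l] is outside the plugged factor, [plug] ignores the center there, and any common center
     [m] will do. *)
  case: common => [[m /andP[m1c m2c]]|nc].
    apply: (plugs A B (size (aword p1 ++ b1)) [::] b1 a b2 m) => //.
    - by rewrite size_cat; clear -bw; lia.
    - exact: K1.
    - by rewrite cats0.
    - by move=> Q m1 _ _ _; rewrite /plug_center lA.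
    - by move=> Q m1 _ _ _; rewrite /plug_center lA.
  (* [A] is nonempty because [l] is at least 1. Its last letter enters the composition and carries
     the center 1, which keeps [l] in place even when [l = size A]. *)
  have [A' [x AE]] : exists A' x, A = rcons A' x.
    case/lastP: (A) lA => [|A' x _]; last by exists A', x.
    by rewrite leqn0; clear -bw; lia.
  have sA : size A = (size A').+1 by rewrite AE size_rcons.
  rewrite -sf in s1; rewrite -sg in s2; have [cl _] := K2 nc s1 s2 x.
  apply: (plugs A' B (size (aword p1 ++ b1)).+1 [:: x] b1 (x :: a) b2 1%N) => //.
  - by rewrite size_cat; clear -bw sA; lia.
  - by rewrite /= W.
  - by rewrite mcE1 -sf s1 /= orbT.
  - by rewrite mcE2 -sg s2 /= orbT.
  - by rewrite AE cats1.
  - by rewrite AE cat_rcons.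
  - move=> Q m1 cr cQ _; rewrite /plug_center cQ l1E.
    have -> : m1 = 1%N by clear -cr bp1; case: cr => [[]|[]|[]] /=; lia.
    by clear -lA sA; case: ifP => ?; [|case: ifP => ?]; lia.
  - move=> Q m2 cr cQ _; rewrite /plug_center cQ l2E.
    have -> : m2 = 1%N by clear -cr bp2; case: cr => [[]|[]|[]] /=; lia.
    by clear -lA sA; case: ifP => ?; [|case: ifP => ?]; lia.
have [ln|nl] := leqP l (size A + size (aword p1 ++ b1)).
  rewrite size_cat in ln.
  (* The position of [l] relative to the overlap word is a common center: it is either the leading
     center of a polynomial or allowed because that polynomial is strong. *)
  have m1c : (l - size A)%N \in centers ltw [::] f b1.
    rewrite mcE1 /=; have [lE|lE] := eqVneq l (size A + center p1)%N.
      by rewrite lE addKn eqxx.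
    rewrite st1; last exact/eqP.
    by clear -c1 lE ln Al bp1 bw; case: c1 => [[]|[]|[]]; lia.
  have m2c : (l - size A)%N \in centers ltw a g b2.
    rewrite mcE2; have [lE|lE] := eqVneq l (size A + size a + center p2)%N.
      by rewrite lE -addnA addKn eqxx.
    rewrite st2; last exact/eqP.
    clear -c2 lE ln Al bp2 bw sW.
    by case: c2 => [[]|[]|[]]; rewrite ?size_cat; lia.
  apply: (plugs A B (size (aword p1 ++ b1)) [::] b1 a b2 (l - size A)%N) => //.
  - by rewrite size_cat; clear -bw; lia.
  - exact: K1.
  - by rewrite cats0.
  - move=> Q m1 cr cQ wQ; rewrite /plug_center cQ (bQ1 _ _ _ wQ) size_cat /=.
    clear -cr c1 Al ln bp1; rewrite [(l <= size A)%N]leqNgt Al ln /=.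
    by case: cr => [[]|[]|[]]; case: c1 => [[]|[]|[]] /=; lia.
  - move=> Q m2 cr cQ wQ; rewrite /plug_center cQ (bQ2 _ _ _ wQ) size_cat.
    clear -cr c2 Al ln bp2; rewrite [(l <= size A)%N]leqNgt Al ln /=.
    by case: cr => [[]|[]|[]]; case: c2 => [[]|[]|[]]; rewrite ?size_cat; lia.
rewrite size_cat in nl.
have s1 : ltw (aword q1) (aword p1) by apply: st1; clear -nl bp1; lia.
have s2 : ltw (aword q2) (aword p2) by apply: st2; clear -nl sW bp2; lia.
have l1E : (l1 + size (aword p1) = l + size (aword q1))%N.
  by clear -c1 nl bp1 Al; case: c1 => [[]|[]|[]]; lia.
have l2E : (l2 + size (aword p2) = l + size (aword q2))%N.
  by clear -c2 nl bp2 sW Al; case: c2 => [[]|[]|[]]; rewrite ?size_cat; lia.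
case: common => [[m /andP[m1c m2c]]|nc].
  apply: (plugs A B (size (aword p1 ++ b1)) [::] b1 a b2 m) => //.
  - by rewrite size_cat; clear -bw; lia.
  - exact: K1.
  - by rewrite cats0.
  - move=> Q m1 _ _ wQ; rewrite /plug_center (bQ1 _ _ _ wQ) size_cat /=.
    by clear -l1E nl Al; case: ifP => ?; [|case: ifP => ?]; lia.
  - move=> Q m2 _ _ wQ; rewrite /plug_center (bQ2 _ _ _ wQ) size_cat /=.
    by clear -l2E nl Al sW; case: ifP => ?; [|case: ifP => ?]; lia.
(* Symmetrically, [l] lies in [B], whose first letter enters the composition as its last letter and
   center. *)
have [y [B' BE]] : exists y B', B = y :: B'.
  case: (B) bw => [|y B' _]; last by exists y, B'.
  by rewrite /=; clear -nl; lia.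
have sB : size B = (size B').+1 by rewrite BE.
rewrite -sf in s1; rewrite -sg in s2; have [_ cl] := K2 nc s1 s2 y.
apply: (plugs A B' (size (aword p1 ++ b1)).+1 [::] (rcons b1 y) a (rcons b2 y)
  (size (aword p1 ++ b1)).+1) => //.
- by rewrite size_cat; clear -bw sB; lia.
- by rewrite /= -!rcons_cat W.
- by rewrite mcE1 -sf s1 size_rcons size_cat /=; clear; lia.
- by rewrite mcE2 -sg s2 size_rcons size_cat; clear -sW; lia.
- by rewrite cats0.
- by rewrite BE cat_rcons.
- by rewrite BE cat_rcons.
- move=> Q m1 cr cQ wQ; rewrite /plug_center cQ (bQ1 _ _ _ wQ).
  rewrite !size_cat size_rcons /= in cr *.
  clear -cr l1E nl Al bp1; case: ifP => ?; [|case: ifP => ?]; try lia.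
  by case: cr => [[]|[]|[]] /=; lia.
- move=> Q m2 cr cQ wQ; rewrite /plug_center cQ (bQ2 _ _ _ wQ).
  rewrite !size_cat size_rcons in cr *.
  clear -cr l2E nl Al bp2 sW; case: ifP => ?; [|case: ifP => ?]; try lia.
  by case: cr => [[]|[]|[]]; lia.
Qed.

End CriticalPairs.

(** One half of Levi's lemma for free monoids; it locates two occurrences in a word relative to each
    other. *)
Lemma cat_eq_cat (A : Type) (s1 t1 s2 t2 : seq A) : s1 ++ t1 = s2 ++ t2 ->
  (size s1 <= size s2)%N -> exists c, s2 = s1 ++ c /\ t1 = c ++ t2.
Proof.
move=> E s12; exists (drop (size s1) s2).
have t : take (size s1) s2 = s1.
  by have := congr1 (take (size s1)) E; rewrite take_size_cat // takel_cat.
split; first by rewrite -{1}(cat_take_drop (size s1) s2) t.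
have := congr1 (drop (size s1)) E; rewrite drop_size_cat // => ->.
by rewrite drop_cat; case: ltngtP s12 => // ->; rewrite drop_size subnn drop0.
Qed.

Section Confluence.
Variables (k : fieldType) (X : choiceType) (ltw : rel (seq X)).
Hypothesis mon : monomial_ordering ltw.
Variables (G : Di k X -> Prop) (T : diword X -> diword X -> Prop).
Implicit Types (p q d e P Q u v w z : diword X) (a b : seq X).
Local Notation lt := (diword_lt ltw).
Local Notation binom p q := (<< p >> - << q >> : Di k X).
Hypothesis Tlt : forall p q, T p q -> lt q p.
Hypothesis GT : forall f, G f -> binomials k T f.
Hypothesis TG : forall p q, T p q -> G (binom p q).
Hypothesis GS : GS_basis ltw G.

(** Disjoint replacements commute: [z] carries both. Its center [lz] is well defined because [l]
    lies inside at most one of the two occurrences. *)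
Lemma disjoint_linked a c b p1 q1 p2 q2 l l1 l2 w u v : T p1 q1 -> T p2 q2 ->
  center_rel a p1 q1 l l1 -> center_rel (a ++ aword p1 ++ c) p2 q2 l l2 ->
  val w = (a ++ aword p1 ++ c ++ aword p2 ++ b, l) ->
  val u = (a ++ aword q1 ++ c ++ aword p2 ++ b, l1) ->
  val v = (a ++ aword p1 ++ c ++ aword q2 ++ b, l2) -> linked ltw T u v.
Proof.
move=> T1 T2 c1 c2 Ew Eu Ev.
have bp1 := diword_bounds p1; have bq1 := diword_bounds q1.
have bp2 := diword_bounds p2; have bq2 := diword_bounds q2.
have bw := val_bounds Ew; have bu := val_bounds Eu; have bv := val_bounds Ev.
rewrite /center_rel !size_cat in c1 c2 bw bu bv.
have [lz [cz1 cz2]] : exists lz, center_rel a p1 q1 l2 lz /\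
    center_rel (a ++ aword q1 ++ c) p2 q2 l1 lz.
  rewrite /center_rel !size_cat.
  clear -c1 c2 bp1 bq1 bp2 bq2 bw bu bv.
  case: c1 => [[la l1E]|[lE l1E]|[al l1E]].
  - exists l1; case: c2 => [[]|[]|[]] *; [|lia|lia].
    by split; apply: Or31; lia.
  - exists l1; case: c2 => [[]|[]|[]] *; [|lia|lia].
    by split; [apply: Or32|apply: Or31]; lia.
  - case: c2 => [[lc l2E]|[l2E l2E']|[al2 l2E]].
    + by exists l1; split; [apply: Or33|apply: Or31]; lia.
    + exists (size a + (size (aword q1) + size c) + center q2)%N.
      by split; [apply: Or33|apply: Or32]; lia.
    + exists (l1 - size (aword p2) + size (aword q2))%N.
      by split; apply: Or33; lia.
have [|z Ez] := @diword_ex X (a ++ aword q1 ++ c ++ aword q2 ++ b) lz.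
  rewrite !size_cat; rewrite /center_rel !size_cat in cz1 cz2.
  clear -cz1 cz2 bp1 bq1 bp2 bq2 bu bv.
  by case: cz1 => [[]|[]|[]] *; case: cz2 => [[]|[]|[]] *; lia.
apply: (@linked_join _ _ _ _ _ z).
  by apply: Edge T2 cz2 _ _; rewrite ?Eu ?Ez -!catA.
exact: Edge T1 cz1 Ev Ez.
Qed.

(** With the first occurrence starting no later, the second is disjoint from it, contained in it, or
    overlaps its end; [d] is the part of [p1] from the start of [p2] on. *)
Lemma critical_pair_le w u v p1 q1 a1 b1 l1 p2 q2 a2 b2 l2 l :
  T p1 q1 -> T p2 q2 -> center_rel a1 p1 q1 l l1 -> center_rel a2 p2 q2 l l2 ->
  val w = (a1 ++ aword p1 ++ b1, l) -> val u = (a1 ++ aword q1 ++ b1, l1) ->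
  val w = (a2 ++ aword p2 ++ b2, l) -> val v = (a2 ++ aword q2 ++ b2, l2) ->
  u <> w -> v <> w -> (size a1 <= size a2)%N -> linked ltw T u v.
Proof.
move=> T1 T2 c1 c2 Ew1 Eu Ew2 Ev uw vw s12.
have W : a1 ++ aword p1 ++ b1 = a2 ++ aword p2 ++ b2.
  by have := Ew2; rewrite Ew1 => -[].
have [c [a2E W1]] := cat_eq_cat W s12; subst a2.
have [pc|cp] := leqP (size (aword p1)) (size c).
  have [d [cE b1E]] := cat_eq_cat W1 pc; subst c b1.
  apply: (disjoint_linked T1 T2 c1 c2 Ew1 Eu).
  by rewrite Ev -!catA.
have [d [p1E W2]] := cat_eq_cat (esym W1) (ltnW cp).
have d0 : (0 < size d)%N by move: cp; rewrite p1E size_cat; clear; lia.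
have overlap := critical_overlap mon Tlt GT TG GS T1 T2 _ _ c1 c2 _ _ _ uw vw.
have [pd|dp] := leqP (size (aword p2)) (size d).
  have [e [dE b2E]] := cat_eq_cat W2 pd; subst d b2.
  apply: (overlap b1 [::] e); rewrite ?cats0 //; last by rewrite Ev -!catA.
  by left.
have [e [p2E b1E]] := cat_eq_cat (esym W2) (ltnW dp); subst b1.
apply: (overlap b2 e [::]); last by rewrite Ev cats0 -!catA.
- by rewrite p1E p2E cats0 -!catA.
- by right; rewrite p2E size_cat; split=> //; clear -d0; lia.
- by rewrite Ew1 -!catA.
- by rewrite Eu -!catA.
Qed.

Lemma critical_pair w u v : edge T w u -> edge T w v -> u <> w -> v <> w ->
  linked ltw T u v.
Proof.
move=> [p1 q1 a1 b1 l l1 T1 c1 Ew1 Eu] [p2 q2 a2 b2 l' l2 T2 c2 Ew2 Ev] uw vw.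
have ll' : l' = l by have := Ew2; rewrite Ew1 => -[].
subst l'; case: (leqP (size a1) (size a2)) => s12.
  exact: (critical_pair_le T1 T2 c1 c2 Ew1 Eu Ew2 Ev).
apply: linked_sym.
exact: (critical_pair_le T2 T1 c2 c1 Ew2 Ev Ew1 Eu _ _ (ltnW s12)).
Qed.

(** * Existence and uniqueness of normal forms *)

Definition reducible_to w u := edge T w u /\ u <> w.

Definition irreducible d := forall u, edge T d u -> u = d.

Definition normal_form w n :=
  clos_refl_trans_1n (diword X) reducible_to w n /\ irreducible n.

Lemma reducible_lt w u : reducible_to w u -> lt u w.
Proof. by case=> /(edge_le mon Tlt)/diword_le_neq_lt; apply. Qed.

Lemma reduce_or_irreducible w : irreducible w \/ exists u, reducible_to w u.
Proof.
have [|nex] := classic (exists u, reducible_to w u); [by right|left=> u wu].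
by apply: NNPP => uw; apply: nex; exists u.
Qed.

Lemma normal_form_step w u n : reducible_to w u -> normal_form u n ->
  normal_form w n.
Proof. by move=> wu [un irr]; split=> //; apply: Relation_Operators.rt1n_trans wu un. Qed.

Lemma normal_form_exists w : exists n, normal_form w n.
Proof.
elim/(well_founded_ind (diword_lt_wf mon)): w => w IH.
have [irr|[u wu]] := reduce_or_irreducible w.
  by exists w; split=> //; apply: rt1n_refl.
by have [n un] := IH u (reducible_lt wu); exists n; apply: normal_form_step un.
Qed.

(** Newman's argument with joinability weakened to connectedness below the peak: by induction every
    step starting below [w] preserves normal forms, hence so does a path linking the first reducts
    [u] and [v]. *)
Lemma normal_form_unique w n m : normal_form w n -> normal_form w m -> n = m.
Proof.
elim/(well_founded_ind (diword_lt_wf mon)): w n m => w IH.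
have same P Q : edge T P Q -> lt P w ->
    forall n, normal_form P n <-> normal_form Q n.
  move=> PQ Pw; have [->|/eqP QP] := eqVneq Q P; first by [].
  have PQ' : reducible_to P Q by split.
  move=> n; split=> [Pn|]; last exact: normal_form_step.
  have [n' Qn'] := normal_form_exists Q.
  by rewrite (IH P Pw n n') //; apply: normal_form_step Qn'.
have linked_same u v : linked ltw T u v -> lt u w -> lt v w ->
    forall n, normal_form u n <-> normal_form v n.
  rewrite /linked; set E := (X in clos_refl_sym_trans _ X) => uv uw vw.
  have E_same P Q : E P Q -> forall n, normal_form P n <-> normal_form Q n.
    move=> [PQ bP]; apply: same => //.
    by case: bP => /(diword_le_lt_trans mon); apply.
  have H P Q : clos_refl_sym_trans (diword X) E P Q ->
      forall n, normal_form P n <-> normal_form Q n.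
    elim=> [{}P {}Q PQ|{}P|{}P {}Q _ IH' n|{}P {}Q R _ IH1 _ IH2 n].
    - exact: E_same.
    - by [].
    - by rewrite IH'.
    - by rewrite IH1.
  exact: H uv.
move=> n m [wn irrn] [wm irrm].
(* If one reduction is empty, [w] is irreducible and the other is empty too. *)
case: wn irrn => [|u n' wu un] irrn.
  case: wm irrm => [//|v m' [wv vw] _ _].
  by case: vw; apply: irrn.
case: wm irrm => [|v m' wv vm] irrm.
  by case: wu => wu []; apply: irrm.
have uv := critical_pair (proj1 wu) (proj1 wv) (proj2 wu) (proj2 wv).
have uw := reducible_lt wu; have vw := reducible_lt wv.
apply: (IH v vw) => //.
by apply/(linked_same u v uv uw vw).
Qed.

(** * Sharing a normal form is a congruence *)

Definition same_normal_form P Q := forall n, normal_form P n <-> normal_form Q n.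

Lemma edge_same_normal_form P Q : edge T P Q -> same_normal_form P Q.
Proof.
move=> PQ n; have [->|/eqP QP] := eqVneq Q P; first by [].
have PQ' : reducible_to P Q by split.
split=> [Pn|]; last exact: normal_form_step.
have [n' Qn'] := normal_form_exists Q.
by rewrite (normal_form_unique Pn (normal_form_step PQ' Qn')).
Qed.

(** [F] may destroy irreducibility, so both sides are compared with [F n], where [n] is the common
    normal form of [P] and [Q]. *)
Lemma same_normal_form_map (F : diword X -> diword X) P Q :
  (forall P Q, edge T P Q -> edge T (F P) (F Q)) ->
  same_normal_form P Q -> same_normal_form (F P) (F Q).
Proof.
move=> Fe PQ.
have red w n : clos_refl_trans_1n (diword X) reducible_to w n ->
    same_normal_form (F w) (F n).
  elim=> [//|u v z [uv _] _ IH] m.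
  by rewrite (edge_same_normal_form (Fe _ _ uv) m) IH.
have [n Pn] := normal_form_exists P; have Qn := proj1 (PQ n) Pn.
by move=> m; rewrite (red _ _ (proj1 Pn) m) (red _ _ (proj1 Qn) m).
Qed.

(** Multiplication by a fixed diword is an instance of [plug], so it preserves steps; the two
    arguments are replaced one after the other. *)
Lemma same_normal_form_congruence :
  @is_congruence (free_disemigroup X) same_normal_form.
Proof.
have plug_map a b n l (F : diword X -> diword X) : (0 < l <= size a + n + size b)%N ->
    (forall e, val (F e) = (a ++ aword e ++ b, plug_center a n l e)) ->
    forall P Q, same_normal_form P Q -> same_normal_form (F P) (F Q).
  move=> lb FE; have FP e : F e = plug a b n l e by apply: val_inj; rewrite val_plug.
  move=> P Q; apply: same_normal_form_map => {}P {}Q PQ.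
  by rewrite !FP; apply: plug_edge.
have trans P Q R : same_normal_form P Q -> same_normal_form Q R ->
    same_normal_form P R by move=> PQ QR n; rewrite PQ QR.
have bounds := @diword_bounds X.
split=> //.
- by move=> P Q PQ n; rewrite PQ.
- move=> P P' Q Q' PP QQ.
  have PQ : same_normal_form (diword_vdash P Q) (diword_vdash P Q').
    (* The length [n] only serves to place [l]: here [n = 1] and [l = size (aword P) + 1] put the
       center inside the factor, while [n = 0] is used when the center belongs to the fixed
       diword. *)
    apply: (plug_map (aword P) [::] 1%N (size (aword P)).+1) QQ; first by lia.
    by move=> e; rewrite /plug_center ltnn addn1 leqnn /= cats0.
  apply: trans PQ _; apply: (plug_map [::] (aword Q') 0%N (center Q')
    (fun e => diword_vdash e Q')) PP; first by have := bounds Q'; rewrite /=; lia.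
  move=> e; rewrite /plug_center /= addn0 leqNgt; case/andP: (bounds Q') => -> _ /=.
  by rewrite subn0 addnC.
- move=> P P' Q Q' PP QQ.
  have PQ : same_normal_form (diword_dashv P Q) (diword_dashv P Q').
    apply: (plug_map (aword P) [::] 0%N (center P)) QQ.
      by have := bounds P; rewrite /=; lia.
    by move=> e; rewrite /plug_center cats0; case/andP: (bounds P) => _ ->.
  apply: trans PQ _; apply: (plug_map [::] (aword Q') 1%N 1%N
    (fun e => diword_dashv e Q')) PP; first by [].
  by move=> e.
Qed.

End Confluence.

(** * Irreducible diwords as representatives of the congruence classes *)

Theorem theorem5p1 (k : fieldType) (X : choiceType)
    (ltX : rel X) (ltX_wo : strict_well_order ltX)
    (ltw : rel (seq X)) (ltw_mon : monomial_ordering ltw)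
    (S : diword X -> diword X -> Prop)
    (S_gt : forall p q, S p q -> diword_lt ltw q p) :
  forall C : Disgp S, exists! d : diword X,
    in_class C d /\ Irr ltw (shirshov ltw (binomials k S)) d.
Proof.
set G := shirshov ltw (binomials k S).
pose cS : diword X -> diword X -> Prop := congruence_gen (D := free_disemigroup X) S.
have cP : @is_congruence (free_disemigroup X) cS by apply: congruence_genP.
(* Membership in [G] is part of [T], so that the binomials of [T] are exactly the elements of
   [G]. *)
pose T p q := [/\ diword_lt ltw q p, cS p q & G (<< p >> - << q >> : Di k X)].
have Tlt p q : T p q -> diword_lt ltw q p by case.
have TG p q : T p q -> G (<< p >> - << q >> : Di k X) by case.
have GT f : G f -> binomials k T f.
  move=> Gf; have [p [q [[qp pq] fE]]] := shirshov_binomials ltw_mon S_gt Gf.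
  by exists p, q; split=> //; split=> //; rewrite -fE.
have GS : GS_basis ltw G.
  apply: (shirshov_GS_basis ltw_mon) => f.
  exact: (binomials_monic ltw_mon).
have edge_cS P Q : edge T P Q -> cS P Q.
  by apply: (edge_in_congruence cP) => p q [].
(* [cS] is the least congruence containing [S], and sharing a normal form is one such congruence. *)
have cS_nf P Q : cS P Q -> same_normal_form T P Q.
  move=> PQ; apply: (PQ _ (same_normal_form_congruence ltw_mon Tlt GT TG GS)).
  move=> p q Spq; apply: (edge_same_normal_form ltw_mon Tlt GT TG GS).
  apply: (@Edge _ T p q p q [::] [::] (center p) (center q)).
  - split; [exact: S_gt|by move=> R _; apply|].
    by exists 0%N; exists p, q; split.
  - exact: Or32.
  - by rewrite cats0 -diword_valE.
  - by rewrite cats0 -diword_valE.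
(* Edges do not require strength, but a proper edge outside the leading center has it, so it comes
   from a normal diword. *)
have irrP d : Irr ltw G d <-> irreducible T d.
  split=> [irr u|irr a f b m Gf mc].
    move=> ed; apply: NNPP => ud; have ltu := reducible_lt ltw_mon Tlt (conj ed ud).
    case: ed => p q a b l l' Tpq c Ed Eu.
    have [f fE] : exists f, f = << p >> - << q >> :> Di k X := ex_intro _ _ erefl.
    have Gf : G f by rewrite fE; apply: TG.
    have bp := diword_bounds p; have bd := val_bounds Ed.
    have lc : l \in centers ltw a f b.
      rewrite (centersUB ltw_mon _ _ _ fE (Tlt _ _ Tpq)).
      have [lE|/eqP lE] := eqVneq l (size a + center p)%N; first by [].
      rewrite (proper_edge_strong Tlt Tpq c Ed Eu ud lE) /=.
      rewrite !size_cat in bd; clear -c bp bd lE.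
      by case: c => [[]|[]|[]]; lia.
    have [P [Q [m [EP EQ cr sdE]]]] := sdiwordUB ltw_mon fE (Tlt _ _ Tpq) lc.
    apply: (irr _ _ _ _ Gf lc); rewrite sdE.
    have -> : P = d by apply: val_inj; rewrite EP Ed.
    (* [center_rel] determines the new center from [l]. *)
    have -> : Q = u.
      apply: val_inj; rewrite EQ Eu; congr (_, _).
      by clear -c cr bp; case: c => [[]|[]|[]]; case: cr => [[]|[]|[]]; lia.
    exact: leadUB.
  have [p [q [Tpq fE]]] := GT _ Gf.
  have [P [Q [m' [EP EQ c sdE]]]] := sdiwordUB ltw_mon fE (Tlt _ _ Tpq) mc.
  have PQ : edge T P Q by apply: Edge Tpq c EP EQ.
  (* A trivial step gives the zero polynomial, which has no leading diword. *)
  rewrite sdE; have [QP|/eqP QP] := eqVneq Q P; first by rewrite QP subrr lead0.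
  have lQP := reducible_lt ltw_mon Tlt (conj PQ QP).
  by rewrite leadUB // => -[Pd]; rewrite Pd in PQ QP; apply/QP/irr.
move=> C; have [x Cx] := in_classP C.
have [n [xn irrn]] := normal_form_exists ltw_mon Tlt x.
have cxn : cS x n.
  elim: xn => [y|y z t [yz _] _ zt]; first exact: (cong_refl cP).
  exact: (cong_trans cP (edge_cS _ _ yz) zt).
exists n; split; first by split; [apply/Cx|apply/irrP].
move=> m [/Cx xm /irrP irrm].
have nfm : normal_form T m m by split=> //; apply: rt1n_refl.
apply: (normal_form_unique ltw_mon Tlt GT TG GS) (proj2 (cS_nf _ _ xm m) nfm).
by split.
Qed.
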